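(* Let $P$ be an $\omega$-hypergraph satisfying the non-emptiness, acyclicity, relevance and segment axioms. Then the graded set $\mathrm{ClosedWF}(P)$ of closed-well-formed fgs's of $P$ (with its source, target, identity and composition operations) is a strict $\omega$-category, and the function $X\mapsto R(\cup X)$ induces an isomorphism of $\omega$-categories between $\mathrm{Cell}(P)$ and $\mathrm{ClosedWF}(P)$.
   Context: An $\omega$-hypergraph is a set $P$ with a partition $P=\bigsqcup_{n\in\mathbb{N}}P_n$ together with, for $n\in\mathbb{N}$ and $u\in P_{n+1}$, two finite subsets $u^-,u^+\subseteq P_n$. For $U\subseteq P$ and $\epsilon\in\{-,+\}$, $U^\epsilon=\bigcup_{u\in U}u^\epsilon$; also $U^\mp=U^-\setminus U^+$ and $U^\pm=U^+\setminus U^-$. A subset $U\subseteq P_n$ is fork-free if either $n=0$ and $|U|=1$, or $n>0$ and $u^\epsilon\cap v^\epsilon=\emptyset$ for all distinct $u,v\in U$ and all $\epsilon\in\{-,+\}$. For $U\subseteq P_n$, $\triangleleft_U$ is the transitive closure of the relation on $U$ relating $u$ to $v$ when $n\ge 1$ and $u^+\cap v^-\neq\emptyset$; a subset $V\subseteq U$ is a segment for $\triangleleft_U$ if $u_1,u_3\in V$ and $u_1\triangleleft_U u_2\triangleleft_U u_3$ imply $u_2\in V$. An $n$-pre-cell of $P$ is a tuple $X=(X_{0,-},X_{0,+},\ldots,X_{n-1,-},X_{n-1,+},X_n)$ of finite subsets $X_{i,\epsilon}\subseteq P_i$, $X_n\subseteq P_n$; one writes $X_{n,-}=X_{n,+}=X_n$.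 For $i<n$, $\partial^\epsilon_i X=(X_{0,-},X_{0,+},\ldots,X_{i-1,-},X_{i-1,+},X_{i,\epsilon})$. A finite set $M\subseteq P_{i+1}$ moves a finite $U\subseteq P_i$ to a finite $V\subseteq P_i$ if $U=(V\cup M^-)\setminus M^+$ and $V=(U\cup M^+)\setminus M^-$. An $n$-cell is an $n$-pre-cell such that $X_{i+1,\epsilon}$ moves $X_{i,-}$ to $X_{i,+}$ for $0\le i<n$, $\epsilon\in\{-,+\}$, and every $X_{i,\epsilon}$ ($0\le i\le n$) is fork-free. $\mathrm{Cell}(P)$ is the graded set of cells. Operations on cells: for an $n$-cell $X$, $\mathrm{id}^{n+1}(X)=(X_{0,-},X_{0,+},\ldots,X_{n-1,-},X_{n-1,+},X_n,X_n,\emptyset)$. For $i<n$ and $n$-cells $X,Y$ with $\partial^+_iX=\partial^-_iY$, $X\ast_iY$ is the $n$-pre-cell $Z$ with $Z_{j,\epsilon}=X_{j,\epsilon}$ for $j<i$, $Z_{i,-}=X_{i,-}$, $Z_{i,+}=Y_{i,+}$, and $Z_{j,\epsilon}=X_{j,\epsilon}\cup Y_{j,\epsilon}$ for $j>i$. Under the axioms below, $\mathrm{Cell}(P)$ is a strict $\omega$-category with these operations. For $u\in P_n$, the atom $\langle u\rangle$ is the $n$-pre-cell with $\langle u\rangle_{n,-}=\langle u\rangle_{n,+}=\{u\}$ and, for $j<n$, $\langle u\rangle_{j,-}=(\langle u\rangle_{j+1,-})^\mp$, $\langle u\rangle_{j,+}=(\langle u\rangle_{j+1,+})^\pm$. Axioms: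 (non-emptiness) $u^-\ne\emptyset$ and $u^+\neq\emptyset$ for all $u\in P_n$, $n\ge1$; (acyclicity) $\triangleleft_{P_n}$ is irreflexive for all $n\geq 1$; (relevance) $\langle u\rangle$ is a cell for all $u\in P$; (segment) for all $k\in\mathbb N$, $u\in P_k$, $n<k$, every $n$-cell $X$ and $\epsilon\in\{-,+\}$, if $\langle u\rangle_{n,\epsilon}\subseteq X_n$ then $\langle u\rangle_{n,\epsilon}$ is a segment for $\triangleleft_{X_n}$. Fgs's: $R\subseteq P\times P$ is the smallest reflexive transitive relation with $x\,R\,y$ whenever $y\in x^-\cup x^+$; for $X\subseteq P$, $R(X)=\{y\mid \exists x\in X,\ x\,R\,y\}$. A finite graded subset of dimension $n$ ($n$-fgs) is a tuple $X=(X_0,\ldots,X_n)$ of finite subsets $X_k\subseteq P_k$; it is often identified with $\bigcup_kX_k$ (but $n$ is part of the data). It is closed if $R(X)=X$. For an $n$-pre-cell $X$, $\cup X$ is the $n$-fgs $\bigcup_{i\le n}(X_{i,-}\cup X_{i,+})$. For $n\ge1$ and a closed $n$-fgs $X$, $\partial^{\mathrm{cl},-}_{n-1}(X)=R(X\setminus(X_n\cup R(X_n^+)))$ and $\partial^{\mathrm{cl},+}_{n-1}(X)=R(X\setminus(X_n\cup R(X_n^-)))$, as closed $(n-1)$-fgs's. A closed $n$-fgs $X$ is closed-well-formed if: $X_n$ is fork-free; when $n\geq1$, $\partial^{\mathrm{cl},-}_{n-1}(X)$ and $\partial^{\mathrm{cl},+}_{n-1}(X)$ are closed-well-formed; and,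 when $n\ge2$, $\partial^{\mathrm{cl},\epsilon}_{n-2}\partial^{\mathrm{cl},-}_{n-1}(X)=\partial^{\mathrm{cl},\epsilon}_{n-2}\partial^{\mathrm{cl},+}_{n-1}(X)$ for $\epsilon\in\{-,+\}$. $\mathrm{ClosedWF}(P)$ is the graded set of closed-well-formed fgs's, with source and target $\partial^{\mathrm{cl},\pm}$, identities $\mathrm{id}^{n+1}(X)=(X_0,\ldots,X_n,\emptyset)$ and, for $i<n$ and $n$-dimensional $X,Y$ such that the $i$-target of $X$ equals the $i$-source of $Y$, composition $X\cup Y$. *)

(* Defs.v *)
From Stdlib Require Import Relation_Operators.
From mathcomp Require Import all_boot.
From mathcomp Require Import boolp classical_sets cardinality.

Set Implicit Arguments.
Unset Strict Implicit.
Unset Printing Implicit Defensive.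

Local Open Scope classical_set_scope.

Variant sign := Minus | Plus.

Definition opp (e : sign) : sign := if e is Minus then Plus else Minus.

(** The partition [P = \bigsqcup_n P_n] is given by the dimension function
    [hdim], with [P_n] the fibre [stage P n].  [face e u] is [u^e]; the field
    [face_dim] says that the faces of an element of [P_(n+1)] lie in [P_n], and
    also that an element of [P_0], which has no faces, is given empty ones. *)
Record omegaHypergraph := OmegaHypergraph {
  hcar :> Type;
  hdim : hcar -> nat;
  face : sign -> hcar -> set hcar;
  face_finite : forall e u, finite_set (face e u);
  face_dim : forall e u v, face e u v -> hdim u = (hdim v).+1
}.

Section Hypergraph.
Variable P : omegaHypergraph.
Implicit Types (U V M : set P) (u v : P) (e : sign) (n i j : nat).

Definition stage n : set P := [set u | hdim u = n].

(** [U^e] *)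
Definition faces e U : set P := \bigcup_(u in U) face e u.

(** [border Minus U] is [U^- \ U^+], [border Plus U] is [U^+ \ U^-]. *)
Definition border e U : set P := faces e U `\` faces (opp e) U.

(** Meant for [U] included in [stage n]. *)
Definition fork_free n U : Prop :=
  (n = 0 /\ exists x, U = [set x]) \/
  (0 < n /\ forall u v e, U u -> U v -> u <> v -> face e u `&` face e v = set0).

(** [tri U] is the transitive closure of [tri1 U].  When [U] is in dimension 0,
    all faces are empty and so is the relation. *)
Definition tri1 U u v : Prop :=
  [/\ U u, U v & face Plus u `&` face Minus v !=set0].

Definition tri U : P -> P -> Prop := clos_trans P (tri1 U).

(** [V] is a segment for [tri U]. *)
Definition is_segment U V : Prop :=
  V `<=` U /\
  forall u1 u2 u3, V u1 -> V u3 -> tri U u1 u2 -> tri U u2 u3 -> V u2.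

Definition moves M U V : Prop :=
  U = (V `|` faces Minus M) `\` faces Plus M /\
  V = (U `|` faces Plus M) `\` faces Minus M.

(** ** Pre-cells and cells *)

(** A tuple [(X_{0,-}, X_{0,+}, ..., X_{n-1,-}, X_{n-1,+}, X_n)] is encoded as
    the function sending [i] and [e] to [X_{i,e}] for [i <= n] (where
    [X_{n,-} = X_{n,+} = X_n]) and to the empty set for [i > n]. *)
Definition precell := nat -> sign -> set P.

Implicit Types X Y : precell.

Definition is_precell n X : Prop :=
  [/\ forall i e, finite_set (X i e) /\ X i e `<=` stage i,
      X n Minus = X n Plus
    & forall i e, n < i -> X i e = set0].

Definition is_cell n X : Prop :=
  [/\ is_precell n X,
      forall i e, i < n -> moves (X i.+1 e) (X i Minus) (X i Plus)
    & forall i e, i <= n -> fork_free i (X i e)].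

Definition precell_bd e i X : precell := fun j e' =>
  if j < i then X j e' else if j == i then X i e else set0.

(** The identity [(X_{0,-}, ..., X_{n-1,+}, X_n, X_n, set0)]: it is given by the
    same function as [X], see [precell]. *)
Definition precell_id X : precell := X.

Definition precell_comp i X Y : precell := fun j e =>
  if j < i then X j e
  else if j == i then (if e is Minus then X i Minus else Y i Plus)
  else X j e `|` Y j e.

(** [atom u] is obtained by descending induction from
    [atom u (hdim u) e = [set u]] by [atom u j e = border e (atom u j.+1 e)]. *)
Definition atom u : precell := fun j e =>
  if j <= hdim u then iter (hdim u - j) (border e) [set u] else set0.

(** ** Axioms *)

Definition nonemptiness_axiom : Prop :=
  forall u e, 0 < hdim u -> face e u !=set0.

Definition acyclicity_axiom : Prop :=
  forall n, 1 <= n -> forall u, ~ tri (stage n) u u.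

Definition relevance_axiom : Prop := forall u, is_cell (hdim u) (atom u).

Definition segment_axiom : Prop :=
  forall u n, n < hdim u -> forall X, is_cell n X -> forall e,
    atom u n e `<=` X n e -> is_segment (X n e) (atom u n e).

(** ** Finite graded subsets *)

(** [R x y] *)
Definition hrel : P -> P -> Prop :=
  clos_refl_trans P (fun x y => face Minus x y \/ face Plus x y).

(** [R(U)] *)
Definition hclosure U : set P := [set y | exists2 x, U x & hrel x y].

(** An [n]-fgs [(X_0, ..., X_n)] is encoded as [n] together with the union of
    the [X_k], from which [X_k] is recovered as [level k]. *)
Definition is_fgs n U : Prop :=
  finite_set U /\ forall u, U u -> hdim u <= n.

Definition level k U : set P := U `&` stage k.

Definition is_closed U : Prop := hclosure U = U.

Definition precell_union n X : set P :=
  [set u | exists i e, i <= n /\ X i e u].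

(** The [(n-1)]-boundary of an [n]-fgs, for [n >= 1]. *)
Definition clbd e n U : set P :=
  hclosure (U `\` (level n U `|` hclosure (faces (opp e) (level n U)))).

(** The iterated boundary, from dimension [n] down to dimension [i]. *)
Fixpoint clbd_iter e n i U : set P :=
  if n is m.+1 then
    if i < n then clbd_iter e m i (clbd e n U) else U
  else U.

Fixpoint closed_wf n U : Prop :=
  [/\ is_fgs n U, is_closed U, fork_free n (level n U)
    & if n is m.+1 then
        (forall e, closed_wf m (clbd e n U)) /\
        (1 <= m -> forall e, clbd e m (clbd Minus n U) = clbd e m (clbd Plus n U))
      else True].

End Hypergraph.

(** ** Strict omega-categories *)

(** A structure of strict omega-category on a graded set [C].  The sources and
    targets [bd Minus], [bd Plus] and the identities [idm] are given between any
    two dimensions [i < n] rather than between consecutive ones only; by [bd_bd]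
    and [idm_idm] they are the iterates of the ones with [n = i.+1].  In the
    laws, the composability proofs are universally quantified; those about
    composites or identities exist by [bd_bd], [bd_idm] and [bd_comp]. *)
Record omegaCat (C : nat -> Type) := OmegaCat {
  bd : forall (e : sign) {n i : nat}, i < n -> C n -> C i;
  idm : forall {i n : nat}, i < n -> C i -> C n;
  comp : forall {n i : nat} (hi : i < n) (X Y : C n),
    bd Plus hi X = bd Minus hi Y -> C n;

  bd_bd : forall (e e' : sign) n j i (hj : j < n) (hi : i < j) (hi' : i < n)
    (X : C n), bd e hi (bd e' hj X) = bd e hi' X;
  idm_idm : forall i j n (hj : i < j) (hn : j < n) (hn' : i < n) (X : C i),
    idm hn (idm hj X) = idm hn' X;

  bd_idm : forall (e : sign) i n (hi : i < n) (X : C i),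
    bd e hi (idm hi X) = X;
  bd_comp_src : forall n i (hi : i < n) (X Y : C n)
    (h : bd Plus hi X = bd Minus hi Y),
    bd Minus hi (comp h) = bd Minus hi X;
  bd_comp_tgt : forall n i (hi : i < n) (X Y : C n)
    (h : bd Plus hi X = bd Minus hi Y),
    bd Plus hi (comp h) = bd Plus hi Y;
  bd_comp : forall (e : sign) n j i (hi : i < n) (hj : j < n) (hij : i < j)
    (X Y : C n) (h : bd Plus hi X = bd Minus hi Y)
    (h' : bd Plus hij (bd e hj X) = bd Minus hij (bd e hj Y)),
    bd e hj (comp h) = comp h';

  comp_idl : forall n i (hi : i < n) (X : C n)
    (h : bd Plus hi (idm hi (bd Minus hi X)) = bd Minus hi X), comp h = X;
  comp_idr : forall n i (hi : i < n) (X : C n)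
    (h : bd Plus hi X = bd Minus hi (idm hi (bd Plus hi X))), comp h = X;
  comp_assoc : forall n i (hi : i < n) (X Y Z : C n)
    (hXY : bd Plus hi X = bd Minus hi Y) (hYZ : bd Plus hi Y = bd Minus hi Z)
    (hl : bd Plus hi (comp hXY) = bd Minus hi Z)
    (hr : bd Plus hi X = bd Minus hi (comp hYZ)), comp hl = comp hr;
  comp_exchange : forall n j i (hi : i < n) (hj : j < n) (X Y X' Y' : C n)
    (hXY : bd Plus hi X = bd Minus hi Y)
    (hXY' : bd Plus hi X' = bd Minus hi Y')
    (hXX : bd Plus hj X = bd Minus hj X')
    (hYY : bd Plus hj Y = bd Minus hj Y')
    (hl : bd Plus hj (comp hXY) = bd Minus hj (comp hXY'))
    (hr : bd Plus hi (comp hXX) = bd Minus hi (comp hYY)),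
    i < j -> comp hl = comp hr;
  idm_comp : forall n m i (hm : n < m) (hi : i < n) (hi' : i < m) (X Y : C n)
    (h : bd Plus hi X = bd Minus hi Y)
    (h' : bd Plus hi' (idm hm X) = bd Minus hi' (idm hm Y)),
    idm hm (comp h) = comp h'
}.

Definition is_functor (C D : nat -> Type) (SC : omegaCat C) (SD : omegaCat D)
    (F : forall n, C n -> D n) : Prop :=
  [/\ forall (e : sign) n i (hi : i < n) (X : C n),
        F i (bd SC e hi X) = bd SD e hi (F n X),
      forall i n (hi : i < n) (X : C i),
        F n (idm SC hi X) = idm SD hi (F i X)
    & forall n i (hi : i < n) (X Y : C n)
        (h : bd SC Plus hi X = bd SC Minus hi Y)
        (h' : bd SD Plus hi (F n X) = bd SD Minus hi (F n Y)),
        F n (comp h) = comp h'].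

Definition is_isomorphism (C D : nat -> Type)
    (SC : omegaCat C) (SD : omegaCat D) (F : forall n, C n -> D n) : Prop :=
  is_functor SC SD F /\
  exists G : forall n, D n -> C n,
    [/\ is_functor SD SC G, forall n, cancel (F n) (G n)
      & forall n, cancel (G n) (F n)].

(** ** The graded sets [Cell(P)] and [ClosedWF(P)] *)

Definition Cell (P : omegaHypergraph) (n : nat) : Type :=
  {X : precell P | is_cell n X}.

Definition ClosedWF (P : omegaHypergraph) (n : nat) : Type :=
  {X : set P | closed_wf n X}.

(** The operations of [S] are the ones of [Cell(P)].  As [sval] is injective,
    this determines all of them. *)
Definition has_Cell_operations (P : omegaHypergraph) (S : omegaCat (Cell P)) :
    Prop :=
  [/\ forall (e : sign) n i (hi : i < n) (X : Cell P n),
        sval (bd S e hi X) = precell_bd e i (sval X),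
      forall i n (hi : i < n) (X : Cell P i),
        sval (idm S hi X) = precell_id (sval X)
    & forall n i (hi : i < n) (X Y : Cell P n)
        (h : bd S Plus hi X = bd S Minus hi Y),
        sval (comp h) = precell_comp i (sval X) (sval Y)].

(** Likewise for [ClosedWF(P)].  The identity [(X_0, ..., X_n, set0)] has the
    same union as [X]. *)
Definition has_ClosedWF_operations (P : omegaHypergraph)
    (S : omegaCat (ClosedWF P)) : Prop :=
  [/\ forall (e : sign) n i (hi : i < n) (X : ClosedWF P n),
        sval (bd S e hi X) = clbd_iter e n i (sval X),
      forall i n (hi : i < n) (X : ClosedWF P i),
        sval (idm S hi X) = sval X
    & forall n i (hi : i < n) (X Y : ClosedWF P n)
        (h : bd S Plus hi X = bd S Minus hi Y),
        sval (comp h) = sval X `|` sval Y].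

(* Main.v *)
Require Import Defs.
From Stdlib Require Import Relation_Operators.
From mathcomp Require Import all_boot.
From mathcomp Require Import boolp classical_sets cardinality.

Set Implicit Arguments.
Unset Strict Implicit.
Unset Printing Implicit Defensive.

Local Open Scope classical_set_scope.

(** Let [act e M A] be [(A \cup M^{-e}) \setminus M^e]. Everything rests on a gluing
    theorem: if [A] is the top dimension of an [n]-cell and [M] is a finite fork-free
    subset of [P_(n+1)] with [border e M] in [A], then [act e M A] is again the top
    dimension of a cell with the same lower boundary, and the new faces are not in [A].
    It is proved by induction on [n], first for singletons and then by removing a
    minimal element of [M]. When two sets are glued one after the other, they share no
    source and no target, and no source of the first is a target of the second:
    otherwise, by acyclicity, the gluings could be reordered so that a face is created
    while it is still present. Hence composites of cells are cells.

    In [ClosedWF], the boundaries of [R(\cup X)] are those of the cell [X], because an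
    element of a lower boundary of [X] that lies below [X_n] lies below the source and
    the target of [X]. Conversely [X] is read off the top levels of the iterated
    boundaries of a closed-well-formed set, so [X |-> R(\cup X)] is bijective and the
    structure of [ClosedWF] is transported along it. *)

(** * Finite sets: induction on proper subsets, minimal elements *)

Lemma finite_set_strong_ind T (Q : set T -> Prop) :
  (forall A, finite_set A ->
     (forall B a, B `<=` A -> A a -> ~ B a -> Q B) -> Q A) ->
  forall A, finite_set A -> Q A.
Proof.
move=> step A /(@finite_seqP {classic T}) [s As].
have {As} : A `<=` [set` s] by rewrite As.
have [n] := ubnP (size s); elim: n s A => // n IHn s A ltsn sAs.
apply: step => [|B a sBA Aa nBa].
  exact: sub_finite_set sAs (finite_seq s).
(* A subset missing [a] is covered by the list with [a] removed, which is shorter. *)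
apply: (IHn [seq x <- s | x != (a : {classic T})] B).
  rewrite ltnS in ltsn; apply: leq_trans ltsn.
  rewrite size_filter -(count_predC (pred1 (a : {classic T})) s) addnC -addn1 leq_add2l.
  by rewrite -has_count has_pred1; exact: sAs.
move=> x Bx /=; rewrite mem_filter (sAs _ (sBA _ Bx)) andbT.
by apply/eqP => xa; apply: nBa; rewrite -xa.
Qed.

(** If [x] is not minimal, a minimal element among those below [x] is minimal in [A] by
    transitivity; irreflexivity keeps [x] out of that smaller set. *)
Lemma finite_set_minimal T (r : T -> T -> Prop) (A : set T) :
  (forall x y z, r x y -> r y z -> r x z) -> (forall x, A x -> ~ r x x) ->
  finite_set A -> A !=set0 -> exists2 x, A x & forall y, A y -> ~ r y x.
Proof.
move=> rT rI fA; move: rI; elim/finite_set_strong_ind: A / fA => A _ IH rI [x Ax].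
have [[y [Ay ryx]]|min_x] := pselect (exists y, A y /\ r y x); last first.
  by exists x => // y Ay ryx; apply: min_x; exists y.
have [|||||m [Am rmx] min_m] := IH [set z | A z /\ r z x] x.
- by move=> z [].
- by [].
- by move=> [_]; exact: rI.
- by move=> z [/rI].
- by exists y.
by exists m => // z Az rzm; apply: (min_m z) => //; split=> //; exact: rT rmx.
Qed.

(** * Moves as one-sided steps *)

Section Sets.
Variable P : omegaHypergraph.
Implicit Types (U V M S T A B : set P) (u v x y z : P) (e : sign).

(** [act Minus M] performs [M] forwards, consuming sources and creating targets; [act Plus M]
    performs it backwards. *)
Definition act e M A : set P := (A `|` faces (opp e) M) `\` faces e M.

Definition disj A B : Prop := forall z, A z -> ~ B z.

Lemma disj_setI0 A B : A `&` B = set0 <-> disj A B.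
Proof.
split=> [AB z Az Bz|AB]; first by have : set0 z by rewrite -AB.
by rewrite -subset0 => z [/AB].
Qed.

(** Splits a move into two conditions on the starting set [A] and a formula for [B], so that moves
    can be built by applying [act]. *)
Definition step e M A B : Prop :=
  [/\ border e M `<=` A, disj (faces (opp e) M) A & B = act e M A].

Lemma movesP M A B : moves M A B <-> step Minus M A B.
Proof.
rewrite /moves /step /act /border /=; split.
- move=> [-> eB]; split; last exact: eB.
  + by move=> z [? ?]; split=> //; right.
  + by move=> z ? [? []].
move=> [sMA dMA eB]; split=> //; rewrite eB.
apply/seteqP; split=> z /=.
  move=> Az; split; last by move/dMA.
  by have [?|?] := pselect (faces Minus M z); [right|left; split=> //; left].
by move=> [[[[//|//] _]|mz] pz]; exact: sMA.
Qed.

Lemma moves_step M A B : moves M A B -> step Plus M B A.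
Proof.
rewrite /moves /step /act /border /= => -[eA eB]; split => //.
- by rewrite eB => z [? ?]; split=> //; right.
- by rewrite eB => z ? [? []].
Qed.

Lemma facesU e S T : faces e (S `|` T) = faces e S `|` faces e T.
Proof. exact: bigcup_setU. Qed.

Lemma faces1 e x : faces e [set x] = face e x.
Proof. exact: bigcup_set1. Qed.

Lemma facesS e S T : S `<=` T -> faces e S `<=` faces e T.
Proof. exact: bigcup_subset. Qed.

Lemma faces_stage e n S : S `<=` stage n.+1 -> faces e S `<=` stage n.
Proof.
move=> sS z [x Sx /face_dim]; have := sS _ Sx; rewrite /stage /= => -> [->] //.
Qed.

(** The index is the dimension of the faces, one less than that of the elements of [M]. *)
Definition mset n M : Prop :=
  [/\ finite_set M, M `<=` stage n.+1 & fork_free n.+1 M].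

Lemma fork_freeS n M : fork_free n.+1 M <->
  forall u v e, M u -> M v -> u <> v -> face e u `&` face e v = set0.
Proof. by split=> [[[]|[_]]|h] //; right. Qed.

Lemma msetS n M S : mset n M -> S `<=` M -> mset n S.
Proof.
move=> [fM sM /fork_freeS ffM] sSM; split.
- exact: sub_finite_set fM.
- by move=> x /sSM /sM.
- by apply/fork_freeS => u v e /sSM Mu /sSM; exact: ffM.
Qed.

Lemma msetU n S T : mset n S -> mset n T ->
  (forall e, disj (faces e S) (faces e T)) -> mset n (S `|` T).
Proof.
move=> [fS sS /fork_freeS ffS] [fT sT /fork_freeS ffT] d; split.
- by rewrite finite_setU.
- by move=> x [/sS|/sT].
- apply/fork_freeS => u v e [Su|Tu] [Sv|Tv] uv; try solve [exact: ffS | exact: ffT];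
    apply/disj_setI0 => z ? ?; apply: (d e z); by [exists u | exists v].
Qed.

Lemma mset_face n M e x y z :
  mset n M -> M x -> M y -> face e x z -> face e y z -> x = y.
Proof.
move=> [_ _ /fork_freeS ffM] Mx My xz yz; apply: contrapT => nxy.
by have : set0 z by rewrite -(ffM x y e).
Qed.

Lemma mset1 n x : hdim x = n.+1 -> mset n [set x].
Proof.
move=> hx; split; first exact: finite_set1.
  by move=> y ->.
by apply/fork_freeS => u v e -> ->.
Qed.


Lemma mset_disj e n S T M : mset n M -> S `<=` M -> T `<=` M -> disj S T ->
  disj (faces e S) (faces e T).
Proof.
move=> mM sSM sTM dST z [x Sx zx] [y Ty zy]; apply: (dST x) => //.
by rewrite (mset_face mM (sSM _ Sx) (sTM _ Ty) zx zy).
Qed.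

Lemma tri_stage n u v z : hdim u = n.+1 -> face Plus u z -> face Minus v z ->
  tri (stage n.+1) u v.
Proof.
move=> hu uz vz; apply: t_step; split=> //; last by exists z.
by rewrite /stage /= (face_dim vz) -(face_dim uz).
Qed.

Lemma tri_trans S u v w : tri S u v -> tri S v w -> tri S u w.
Proof. exact: t_trans. Qed.

(** The hypothesis says that [T] creates nothing that [S] consumes, so [S] can be performed
    first. *)
Lemma border_split e S T A : disj (faces (opp e) T) (faces e S) ->
  border e (S `|` T) `<=` A -> border e S `<=` A.
Proof.
move=> dTS sA z [Sz nSz]; apply: sA; split; rewrite facesU; first by left.
by move=> [//|/dTS].
Qed.

(** What [T] needs is either created by [S] or already in [A], and [S] does not consume it. *)
Lemma border_split_act e S T A : disj (faces e S) (faces e T) ->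
  border e (S `|` T) `<=` A -> border e T `<=` act e S A.
Proof.
move=> dST sA z [Tz nTz]; split; last by move/dST.
have [|nSz] := pselect (faces (opp e) S z); first by right.
by left; apply: sA; split; rewrite facesU; [right | case].
Qed.

Lemma actU e S T A : disj (faces (opp e) T) (faces e S) ->
  act e (S `|` T) A = act e T (act e S A).
Proof.
by rewrite /act !facesU => d; apply/seteqP; split=> z /=; have := d z; tauto.
Qed.

Lemma borderU e S T A :
  border e S `<=` A -> border e T `<=` act e S A -> border e (S `|` T) `<=` A.
Proof.
rewrite /border !facesU => sA sT z /= [[Sz|Tz] nST].
  by apply: sA; split=> // ?; apply: nST; left.
have [|[//|?] _] := sT z; first by split=> // ?; apply: nST; right.
by case: nST; left.
Qed.

(** * Two sets performed one after the other *)

Section Consecutive.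
(** [ok] stands for being the top of an [n]-cell with fixed lower part. It is abstract because the
    section serves both inside the induction for the gluing theorem and after it. *)
Variables (n : nat) (ok : set P -> Prop).
Hypothesis acyclic : forall u, ~ tri (stage n.+1) u u.
Hypothesis ok_act : forall M A, mset n M -> ok A -> border Minus M `<=` A ->
  disj (faces Plus M) A /\ ok (act Minus M A).

(* Otherwise some [t] in [T] creates a face [z] consumed by [s] in [S]; the part
   of [T] not after [s] can be run before the part of [S] from [s] on, and
   creates [z] at a time when it is present. *)
Lemma consecutive_disj S T A : mset n S -> mset n T -> ok A ->
  border Minus S `<=` A -> border Minus T `<=` act Minus S A ->
  disj (faces Minus S) (faces Plus T).
Proof.
move=> mS mT okA sSA sTA z [s Ss sz] [t Tt tz].
have st (M : set P) u : mset n M -> M u -> hdim u = n.+1 by move=> [_ + _] => /[apply].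
have bsplit := @border_split Minus.
(* [S1] and [T1] collect what comes from [s] on, [S0] and [T0] the rest. A set of the first kind
   never feeds one of the second, since le_s is closed under feeding. *)
pose le_s x := x = s \/ tri (stage n.+1) s x.
pose S0 := [set x | S x /\ ~ le_s x]; pose S1 := [set x | S x /\ le_s x].
pose T0 := [set x | T x /\ ~ le_s x].
pose T1 := [set x | T x /\ le_s x].
have eS : S = S0 `|` S1.
  apply/seteqP; split=> x; last by case=> -[].
  by move=> Sx; have [?|?] := pselect (le_s x); [right|left].
have eT : T = T0 `|` T1.
  apply/seteqP; split=> x; last by case=> -[].
  by move=> Tx; have [?|?] := pselect (le_s x); [right|left].
have le_next x y w : hdim x = n.+1 -> le_s x -> face Plus x w -> face Minus y w -> le_s y.
  move=> hx lx xw yw; right; have xy := tri_stage hx xw yw.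
  by case: lx => [<- //|sx]; exact: tri_trans xy.
have dS : disj (faces Plus S1) (faces Minus S0).
  by move=> w [x [Sx lx] xw] [y [Sy +] yw]; apply; apply: le_next xw yw => //; exact: st Sx.
have dT : disj (faces Plus T1) (faces Minus T0).
  by move=> w [x [Tx lx] xw] [y [Ty +] yw]; apply; apply: le_next xw yw => //; exact: st Tx.
have dST : disj (faces Plus S1) (faces Minus T0).
  by move=> w [x [Sx lx] xw] [y [Ty +] yw]; apply; apply: le_next xw yw => //; exact: st Sx.
have sS0 : S0 `<=` S by rewrite eS; exact: subsetUl.
have sS1 : S1 `<=` S by rewrite eS; exact: subsetUr.
have sT0 : T0 `<=` T by rewrite [X in _ `<=` X]eT; exact: subsetUl.
have d01 : disj (faces Minus S0) (faces Minus S1).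
  by apply: mset_disj mS sS0 sS1 _ => x [_ +] [_]; apply.
have sS0A : border Minus S0 `<=` A by apply: bsplit dS _; rewrite -eS.
have sS1A : border Minus S1 `<=` act Minus S0 A by apply: border_split_act; rewrite -?eS.
have [_ okA0] := ok_act (msetS mS sS0) okA sS0A.
(* A source of [T0] that is present after [S] was not created by [S1], so it is already present
   after [S0]. *)
have sT0A : border Minus T0 `<=` act Minus S0 A.
  move=> w wT0; have [|wA0 _] := bsplit _ _ (act Minus S A) dT _ _ wT0.
    by rewrite -eT.
  case: (wT0) => wm _.
  have : act Minus S1 (act Minus S0 A) w.
    by rewrite -actU // -eS; apply: bsplit dT _ _ wT0; rewrite -eT.
  by move=> [[//|/dST /(_ wm)]].
have [T0A _] := ok_act (msetS mT sT0) okA0 sT0A.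
(* By gluing, [T0] creates nothing already present after [S0]. But [t] feeds [s], so it lies in
   [T0]; and [s] needs [z], which nothing in [S1] creates, so [z] is present after [S0]. *)
apply: (T0A z).
  exists t => //; split=> // lt; case: (@acyclic s).
  have ts := tri_stage (st _ _ mT Tt) tz sz.
  by case: lt => [ts'|st']; [rewrite ts' in ts|exact: tri_trans st' ts].
apply: sS1A; split; first by exists s => //; split=> //; left.
move=> [x [Sx lx] xz]; case: (@acyclic s).
have xs := tri_stage (st _ _ mS Sx) xz sz.
by case: lx => [xs'|sx]; [rewrite xs' in xs|exact: tri_trans sx xs].
Qed.

(** A shared source would be gone after [S], yet [T] needs it; a shared target would still be
    present after [S] when [T] creates it, against gluing. *)
Lemma consecutive_step S T A : mset n S -> mset n T -> ok A ->
  border Minus S `<=` A -> border Minus T `<=` act Minus S A ->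
  [/\ mset n (S `|` T), border Minus (S `|` T) `<=` A,
      act Minus (S `|` T) A = act Minus T (act Minus S A)
    & forall e, disj (faces e S) (faces e T)].
Proof.
move=> mS mT okA sSA sTA; have dST := consecutive_disj mS mT okA sSA sTA.
have [_ okSA] := ok_act mS okA sSA.
have [dTA _] := ok_act mT okSA sTA.
have d e : disj (faces e S) (faces e T).
  case: e => z Sz Tz.
    have [|_ //] := sTA z.
    by split=> //; exact: dST.
  have [Smz|nSmz] := pselect (faces Minus S z); first exact: (dST z).
  by apply: (dTA z) => //; split=> //; right.
split=> //.
- exact: msetU.
- exact: borderU.
- by apply: actU => z Tz Sz; exact: dST Tz.
Qed.

End Consecutive.

End Sets.

(** * Cells with a prescribed top dimension *)

Section Cells.
Variable P : omegaHypergraph.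
Implicit Types (U V M S T A B : set P) (u v x y z : P) (e : sign) (X Y : precell P).

(** Only the part of [X] below dimension [n] matters; gluing varies [A] while this part stays
    fixed. *)
Definition top n X A : precell P := fun j e =>
  if j < n then X j e else if j == n then A else set0.

Lemma precell_bdE e i X : precell_bd e i X = top i X (X i e). Proof. by []. Qed.

Lemma top_lt n X A j e : j < n -> top n X A j e = X j e.
Proof. by rewrite /top => ->. Qed.

Lemma top_eq n X A e : top n X A n e = A.
Proof. by rewrite /top ltnn eqxx. Qed.

Lemma top_gt n X A j e : n < j -> top n X A j e = set0.
Proof. by rewrite /top => nj; rewrite ltnNge ltnW //= gtn_eqF. Qed.

Lemma eq_top n X Y A : (forall j e, j < n -> X j e = Y j e) -> top n X A = top n Y A.
Proof.
by move=> eXY; apply/funext=> j; apply/funext=> e; rewrite /top; case: ifP => // /eXY.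
Qed.

Lemma top_id n X e : is_precell n X -> top n X (X n e) = X.
Proof.
move=> [_ Xn X0]; apply/funext=> j; apply/funext=> e'.
by rewrite /top; case: ltngtP => [//|/X0 //|->]; case: e e' => [] [].
Qed.

Lemma top_idem n X A A' : top n (top n X A) A' = top n X A'.
Proof. by apply: eq_top => j e jn; rewrite top_lt. Qed.

Lemma cell_top n X e : is_cell n X -> is_cell n (top n X (X n e)).
Proof. by move=> cX; rewrite top_id //; case: cX. Qed.

Lemma cell_bd i n X e : i <= n -> is_cell n X -> is_cell i (top i X (X i e)).
Proof.
move=> le_in [[Xfs Xn X0] Xm Xf]; split.
- split=> [j e'||j e' ij]; last by rewrite top_gt.
    rewrite /top; case: ifP => // _; case: eqP => [->|_] //.
    by split=> //; exact: finite_set0.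
  by rewrite !top_eq.
- move=> j e' ji; have jn := leq_trans ji le_in.
  rewrite !(top_lt _ _ _ ji); have [ji'|] := ltnP j.+1 i.
    by rewrite top_lt //; exact: Xm.
  move=> ij; have -> : i = j.+1 by apply/eqP; rewrite eqn_leq ij.
  by rewrite top_eq; exact: Xm.
- move=> j e'; rewrite leq_eqVlt => /orP[/eqP->|ji].
    by rewrite top_eq; exact: Xf.
  by rewrite top_lt //; apply: Xf; exact: leq_trans (ltnW ji) le_in.
Qed.

Lemma cell_mset n X i e : is_cell n X -> i < n -> mset i (X i.+1 e).
Proof. by move=> [[Xfs _ _] _ Xf] ltin; split; [apply Xfs..|exact: Xf]. Qed.

Lemma cell_topS n X M : is_cell n.+1 (top n.+1 X M) <->
  [/\ forall e, is_cell n (top n X (X n e)), mset n M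
    & moves M (X n Minus) (X n Plus)].
Proof.
split=> [cX|[cX [fM sM ffM] mM]].
  split.
  - move=> e; have := cell_bd e (leqnSn n) cX.
    rewrite (@top_lt n.+1) // (@eq_top n _ X) // => j e' jn.
    by rewrite top_lt //; exact: ltnW.
  - by have := cell_mset Minus cX (ltnSn n); rewrite top_eq.
  - by case: cX => _ /(_ n Minus (ltnSn n)) + _; rewrite top_eq !top_lt.
split.
- split; [|by rewrite !top_eq|by move=> i e; exact: top_gt].
  move=> i e; have [le_in|] := ltnP i n.+1; last first.
    rewrite leq_eqVlt => /orP[/eqP<-|ni]; first by rewrite top_eq.
    by rewrite top_gt //; split=> //; exact: finite_set0.
  rewrite top_lt //; have [[/(_ i e) + _ _] _ _] := cX e.
  by move: le_in; rewrite ltnS leq_eqVlt => /orP[/eqP->|lin]; rewrite (top_eq, top_lt).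
- move=> i e; rewrite ltnS leq_eqVlt => /orP[/eqP->|lin].
    by rewrite top_eq !top_lt.
  have [_ /(_ i e lin) + _] := cX e.
  rewrite !(top_lt _ _ _ lin) !(@top_lt n.+1) //; [|exact: ltnW..].
  move: lin; rewrite leq_eqVlt => /orP[/eqP->|lin]; rewrite (top_eq, top_lt) //.
- move=> i e; rewrite leq_eqVlt => /orP[/eqP->|].
    by rewrite top_eq.
  move=> lin; rewrite top_lt //; have [_ _ /(_ i e lin)] := cX e.
  by move: lin; rewrite ltnS leq_eqVlt => /orP[/eqP->|lin]; rewrite (top_eq, top_lt).
Qed.

Lemma cell_top0 X A : is_cell 0 (top 0 X A) <-> exists2 a, hdim a = 0 & A = [set a].
Proof.
split=> [[[/(_ 0 Minus)]]|[a ha ->]].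
  rewrite top_eq => -[_ sA] _ _ _ /(_ 0 Minus (leqnn 0)).
  rewrite top_eq => -[[_ [a Aa]]|[//]].
  by exists a => //; apply: sA; rewrite Aa.
split=> //.
  split=> [i e||i e ?]; [|by rewrite !top_eq|exact: top_gt].
  rewrite /top ltn0; case: eqP => [->|_]; first by split; [exact: finite_set1|move=> _ ->].
  by split=> //; exact: finite_set0.
by move=> [|//] e _; rewrite top_eq; left; split=> //; exists a.
Qed.

(** * Faces, atoms and extremal elements *)

Hypothesis nonempty : nonemptiness_axiom P.
Hypothesis acyclic : acyclicity_axiom P.
Hypothesis relevant : relevance_axiom P.
Hypothesis segment : segment_axiom P.

(** An element having a common source and target would precede itself. *)
Lemma face_disj e x : disj (face e x) (face (opp e) x).
Proof.
move=> z; wlog: e / e = Minus.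
  by case: e => [|h ? ?]; [exact|apply: (h Minus)].
move=> -> /= mz pz; apply: (@acyclic (hdim z).+1 _ x) => //.
by apply: (tri_stage _ pz mz); exact: face_dim mz.
Qed.

Lemma atom_top x e : atom x (hdim x) e = [set x].
Proof. by rewrite /atom leqnn subnn. Qed.

Lemma atomE x n e : n < hdim x -> atom x n e = border e (atom x n.+1 e).
Proof. by move=> nx; rewrite /atom nx ltnW // -[in LHS]subSS (subSn nx). Qed.

Lemma atom_face n x e : hdim x = n.+1 -> atom x n e = face e x.
Proof.
move=> hx; rewrite atomE ?hx // -hx atom_top /border !faces1.
by apply/seteqP; split=> z /=; [case|split=> //; exact: face_disj].
Qed.

Lemma face_mset n x e : hdim x = n.+2 -> mset n (face e x).
Proof.
move=> hx; have := cell_mset e (relevant x) (i := n).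
by rewrite atom_face // hx; apply.
Qed.

(** By relevance both faces of [x] perform the same move, from the source of [face Minus x] to the
    target of [face Plus x]; comparing the two moves gives the equality. *)
Lemma face_border n x e : hdim x = n.+2 -> border e (face Minus x) = border e (face Plus x).
Proof.
move=> hx; have [_ mx _] := relevant x.
have mx' e' : moves (face e' x) (border Minus (face Minus x)) (border Plus (face Plus x)).
  by have := mx n e'; rewrite !(atomE (n := n)) ?hx // !(atom_face _ hx); exact.
have [_ mE] := mx' Minus; have [pE _] := mx' Plus.
case: e; [rewrite pE|rewrite mE]; apply/seteqP; split=> z; rewrite /border /=; tauto.
Qed.

Lemma minimal_face n e S : finite_set S -> S `<=` stage n.+1 -> S !=set0 ->
  exists2 x, S x & disj (faces (opp e) S) (face e x).
Proof.
move=> fS sS S0.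
(* For [Plus] the order is reversed, so the extremal element found is maximal. *)
pose r y x := if e is Minus then tri (stage n.+1) y x else tri (stage n.+1) x y.
have [||x Sx minx] := finite_set_minimal (r := r) _ _ fS S0.
- rewrite /r; case: (e) => x y z; first exact: tri_trans.
  by move=> yx zy; exact: tri_trans zy yx.
- by rewrite /r => x _; case: (e); exact: acyclic.
exists x => // z [y Sy yz] xz; apply: (minx y) => //.
rewrite /r; case: (e) yz xz => yz xz; first by apply: tri_stage yz xz; exact: sS.
by apply: tri_stage xz yz; exact: sS.
Qed.

(** * The gluing theorem *)

Definition act_cell n : Prop := forall e X A M,
  is_cell n (top n X A) -> mset n M -> border e M `<=` A ->
  disj (faces (opp e) M) A /\ is_cell n (top n X (act e M A)).

Lemma stage_nonempty n e x : stage n.+1 x -> face e x !=set0.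
Proof. by move=> hx; apply: nonempty; rewrite hx. Qed.

(** By non-emptiness a common element would provide a common face. *)
Lemma disj_of_faces n e S T : S `<=` stage n.+1 -> disj (faces e S) (faces e T) ->
  disj S T.
Proof.
move=> sS d x Sx Tx; have [z xz] := stage_nonempty e (sS _ Sx).
by apply: (d z); exists x.
Qed.

(** Under these hypotheses [act] depends on [M] only through its borders, which allows [face e x] to
    be exchanged for [face (opp e) x]. *)
Lemma act_border M A : border Minus M `<=` A -> disj (faces Plus M) A ->
  act Minus M A = (A `\` border Minus M) `|` border Plus M.
Proof.
move=> sM dM; apply/seteqP; split=> z; rewrite /act /border /=; last first.
  move=> [[Az nMz]|]; last by tauto.
  split; first by left.
  by move=> ?; apply: nMz; split=> // /dM.
by tauto.
Qed.

(** The 0-cell is a point, which must be the whole of [face e x]; by relevance the other face of [x]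
    is also a single point and replaces it. *)
Lemma act_cell1_0 e X A x : is_cell 0 (top 0 X A) -> hdim x = 1 -> face e x `<=` A ->
  disj (face (opp e) x) A /\ is_cell 0 (top 0 X (act e [set x] A)).
Proof.
move=> /cell_top0[a ha ->] hx sxa; have [z xz] := stage_nonempty e hx.
have xa : face e x a by rewrite -(sxa _ xz).
have xE : face e x = [set a] by apply/seteqP; split=> // _ ->.
have d := face_disj (e := e) (x := x).
split; first by move=> w xw wa; apply: (d w) => //; rewrite wa.
apply/cell_top0; have [_ _ /(_ 0 (opp e) isT)] := relevant x.
rewrite atom_face // => -[[_ [b xb]]|[//]]; exists b.
  have /face_dim : face (opp e) x b by rewrite xb.
  by rewrite hx => -[].
rewrite -xb /act !faces1 xE; apply/seteqP; split=> w /=; first by case=> -[].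
by move=> wb; split; [right|move=> wa; apply: (d w); rewrite // wa].
Qed.

(* By the segment axiom [A] splits into [U], [face e x], [V], performed in this order
   from [X n Minus]; as [face e x] and [face (opp e) x] have the same borders, the
   latter can be performed instead between [U] and [V]. *)
Lemma act_cell1_S n e X A x : act_cell n -> is_cell n.+1 (top n.+1 X A) ->
  hdim x = n.+2 -> face e x `<=` A ->
  disj (face (opp e) x) A /\ is_cell n.+1 (top n.+1 X (act e [set x] A)).
Proof.
move=> Gn cA hx sxA.
have [] := @segment x n.+1 _ _ cA e; rewrite ?hx // ?atom_face // top_eq // => _ segx.
have [cC mA moveA] := (cell_topS n X A).1 cA.
have [sAC dAC DE] := (movesP _ _ _).1 moveA.
set C := X n Minus in cC moveA sAC dAC DE; pose E := face e x; pose E' := face (opp e) x.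
pose ok B := is_cell n (top n X B).
have Gok M B : mset n M -> ok B -> border Minus M `<=` B ->
    disj (faces Plus M) B /\ ok (act Minus M B).
  by move=> mM okB; exact: (Gn Minus).
have acyc u : ~ tri (stage n.+1) u u by exact: acyclic.
pose U := [set u | A u /\ ~ E u /\ exists2 w, E w & tri A u w].
pose V := [set u | A u /\ ~ E u /\ ~ exists2 w, E w & tri A u w].
have eA : A = (U `|` E) `|` V.
  apply/seteqP; split=> [w Aw|w]; last by case=> [[[]|/sxA]|[]].
  have [Ew|nEw] := pselect (E w); first by left; right.
  by have [?|?] := pselect (exists2 w', E w' & tri A w w'); [left; left|right].
have sUA : U `<=` A by move=> w [].
have sVA : V `<=` A by move=> w [].
have sEA : E `<=` A by [].
have sUEA : U `|` E `<=` A by move=> w [/sUA|/sEA].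
have next u v z : A u -> A v -> face Plus u z -> face Minus v z -> tri A u v.
  by move=> Au Av uz vz; apply: t_step; split=> //; exists z.
(* An element of [U] fed by [E] would lie between two elements of [E], hence in [E] by the segment
   axiom. *)
have dEU : disj (faces Plus E) (faces Minus U).
  move=> z [u Eu uz] [v [Av [nEv [w Ew vw]]] vz]; apply: nEv.
  by apply: (segx u v w) => //; apply: next uz vz; first exact: sEA.
have dVUE : disj (faces Plus V) (faces Minus (U `|` E)).
  move=> z [u [Au [nEu nU]] uz] [v UEv vz]; apply: nU.
  have uv : tri A u v by apply: next uz vz => //; exact: sUEA.
  case: UEv => [[_ [_ [w Ew vw]]]|Ev]; last by exists v.
  by exists w => //; exact: tri_trans uv vw.
have dMUE : disj (faces Minus U) (faces Minus E).
  by apply: mset_disj mA sUA sEA _ => w [_ [? _]].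
have dMUEV : disj (faces Minus (U `|` E)) (faces Minus V).
  by apply: mset_disj mA sUEA sVA _ => w [[_ [nE [w' ? ?]]]|?] [_ [nE' +]];
    [apply; exists w'|].
have mU := msetS mA sUA; have mV := msetS mA sVA; have mE := msetS mA sEA.
have mE' : mset n E' by exact: face_mset.
have bE e' : border e' E = border e' E'.
  by rewrite /E /E'; case: (e); rewrite /= (face_border _ hx).
have okC : ok C by exact: cC.
have sUEC : border Minus (U `|` E) `<=` C.
  by apply: (border_split (e := Minus) (T := V)); rewrite // -eA.
have sUC : border Minus U `<=` C by exact: (border_split (e := Minus) dEU).
have [_ okA1] := Gok _ _ mU okC sUC; set A1 := act Minus U C in okA1.
have sEA1 : border Minus E `<=` A1 by exact: border_split_act dMUE sUEC.
have sE'A1 : border Minus E' `<=` A1 by rewrite -bE.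
have [dE'A1 _] := Gok _ _ mE' okA1 sE'A1.
have [dEA1 _] := Gok _ _ mE okA1 sEA1.
have aE : act Minus E' A1 = act Minus E A1 by rewrite !act_border // !bE.
(* Performing [U], [E'], [V] in turn from [C], two uses of [consecutive_step] turn their union [A']
   into a single move with the same result as [A]. *)
have [mUE' sUE'C aUE' dUE'] := consecutive_step acyc Gok mU mE' okC sUC sE'A1.
have aUE : act Minus (U `|` E) C = act Minus E A1 by exact: (actU (e := Minus)).
have sVB1 : border Minus V `<=` act Minus (U `|` E') C.
  by rewrite aUE' aE -aUE; apply: border_split_act dMUEV _; rewrite -eA.
have [mA' sA'C aA' dUE'V] := consecutive_step acyc Gok mUE' mV okC sUE'C sVB1.
have aA : act Minus A C = act Minus V (act Minus E A1).
  by rewrite eA (actU (e := Minus)) // aUE.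
set A' := (U `|` E') `|` V in mA' sA'C aA'.
have [dA'C _] := Gok _ _ mA' okC sA'C.
have dE'A : disj E' A.
  have sE' : E' `<=` stage n.+1 by case: mE'.
  have dE'U : disj E' U.
    by move=> w E'w Uw; have [_ sU _] := mU; exact: (disj_of_faces sU (dUE' Minus)) Uw E'w.
  have dE'V : disj E' V.
    move=> w E'w; have [_ sUE' _] := mUE'; apply: (disj_of_faces sUE' (dUE'V Minus)).
    by right.
  by move=> w E'w; rewrite eA => -[[/dE'U|/(face_disj (e := e) (x := x))]|/dE'V]; exact.
split=> //.
have -> : act e [set x] A = A'.
  rewrite /act !faces1 -/E -/E' eA.
  apply/seteqP; split=> w /=; first by rewrite /A' /=; tauto.
  move=> [[[Aw [nEw tw]]|E'w]|[Aw [nEw tw]]]; split=> //; try by left; [left; left|right].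
  - by left; left; left.
  - by right.
  - by move=> Ew; exact: (face_disj Ew).
  - by left; right.
apply/cell_topS; split=> //; apply/movesP; split=> //.
by rewrite aA' aUE' aE -aA.
Qed.

(** Peel off an element [g] extremal in the direction [e]: nothing in [M] creates what [g] needs, so
    [face e g] already lies in [A]. Glue [g], then the rest by induction. *)
Lemma act_cell_of1 n :
  (forall e X A x, is_cell n (top n X A) -> hdim x = n.+1 -> face e x `<=` A ->
     disj (face (opp e) x) A /\ is_cell n (top n X (act e [set x] A))) ->
  act_cell n.
Proof.
move=> G1 e X A M; move=> + mM; have [fM _ _] := mM; move: M fM mM A.
apply: finite_set_strong_ind => M fM IH mM A cA sMA.
have [->|M0] := eqVneq M set0.
  by rewrite /act /faces !bigcup_set0 setU0 setD0; split.
have sM : M `<=` stage n.+1 by case: mM.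
have [g Mg dg] := minimal_face e fM sM ((set0P M).1 M0).
pose M' := M `\ g.
have eM : M = [set g] `|` M'.
  apply/seteqP; split=> w; last by move=> [->|[]].
  by move=> Mw; have [?|?] := pselect (w = g); [left|right].
have sM'M : M' `<=` M by move=> w [].
have dM' : disj (faces (opp e) M') (faces e [set g]).
  by move=> z /(facesS sM'M) /dg; rewrite faces1.
have sgA : face e g `<=` A.
  move=> z gz; apply: sMA; split; first by exists g.
  by move=> /dg.
have [dgA cA1] := G1 e X A g cA (sM _ Mg) sgA.
have mM' := msetS mM sM'M.
have sM'A1 : border e M' `<=` act e [set g] A.
  apply: border_split_act; rewrite -?eM //.
  by apply: mset_disj mM _ sM'M _ => w ->; [|case=> _; apply].
have [|||d c] := IH M' g _ _ _ mM' _ cA1 sM'A1 => //; first by case=> _; apply.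
rewrite eM actU //; split=> // z; rewrite facesU faces1 => -[/dgA //|M'z] Az.
by apply: (d z) => //; split; [left|exact: dM'].
Qed.

Theorem act_cellP n : act_cell n.
Proof.
elim: n => [|n IHn]; apply: act_cell_of1 => e X A x.
  exact: act_cell1_0.
exact: act_cell1_S.
Qed.

End Cells.

(** * Composites of cells are cells *)

Section Composition.
Variable P : omegaHypergraph.
Implicit Types (U V M S T A B : set P) (u v x y z : P) (e : sign) (X Y : precell P).

Lemma actUl e S A B : disj (faces e S) B -> act e S (A `|` B) = act e S A `|` B.
Proof. by move=> d; apply/seteqP; split=> z; rewrite /act /=; have := d z; tauto. Qed.

Lemma actUr e S A B : disj (faces e S) B -> act e S (B `|` A) = B `|` act e S A.
Proof. by rewrite setUC [RHS]setUC; exact: actUl. Qed.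

Lemma precell_comp_lt i X Y j e : j < i -> precell_comp i X Y j e = X j e.
Proof. by rewrite /precell_comp => ->. Qed.

Lemma precell_comp_eq i X Y e :
  precell_comp i X Y i e = if e is Minus then X i Minus else Y i Plus.
Proof. by rewrite /precell_comp ltnn eqxx. Qed.

Lemma precell_comp_gt i X Y j e : i < j -> precell_comp i X Y j e = X j e `|` Y j e.
Proof. by rewrite /precell_comp => ij; rewrite ltnNge ltnW //= gtn_eqF. Qed.

Lemma top_comp m i X Y A B : i < m ->
  precell_comp i (top m X A) (top m Y B) = top m (precell_comp i X Y) (A `|` B).
Proof.
move=> im; apply/funext=> j; apply/funext=> e; rewrite /top /precell_comp.
case: (ltngtP j i) => [ji|ij|->]; last by rewrite im.
  by rewrite (ltn_trans ji im).
by case: ltngtP => // _; rewrite setU0.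
Qed.

Hypothesis nonempty : nonemptiness_axiom P.
Hypothesis acyclic : acyclicity_axiom P.
Hypothesis relevant : relevance_axiom P.
Hypothesis segment : segment_axiom P.

Lemma cell_act n X A M : is_cell n (top n X A) -> mset n M -> border Minus M `<=` A ->
  disj (faces Plus M) A /\ is_cell n (top n X (act Minus M A)).
Proof. exact: (act_cellP nonempty acyclic relevant segment (e := Minus)). Qed.

(** By [consecutive_step], performing [S] and then [T] from [A] is one move of their union; the
    function in the statement overrides [X] in dimension [n] only, by the two ends of this move. *)
Lemma cell_consecutive n X S T A :
  mset n S -> mset n T -> is_cell n (top n X A) ->
  border Minus S `<=` A -> border Minus T `<=` act Minus S A ->
  [/\ is_cell n.+1 (top n.+1 (fun j e => if j == n then
         if e is Minus then A else act Minus T (act Minus S A) else X j e) (S `|` T))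
    & disj S T].
Proof.
move=> mS mT cA sSA sTA.
have acyc u : ~ tri (stage n.+1) u u by exact: acyclic.
have Gok M B : mset n M -> is_cell n (top n X B) -> border Minus M `<=` B ->
    disj (faces Plus M) B /\ is_cell n (top n X (act Minus M B)).
  by move=> mM okB; exact: cell_act.
have [mST sST eST dST] := consecutive_step (ok := fun A => is_cell n (top n X A))
  acyc Gok mS mT cA sSA sTA.
have [dSTA cSTA] := Gok _ _ mST cA sST.
split; last by have [_ sS _] := mS; exact: disj_of_faces sS (dST Minus).
apply/cell_topS; split=> //.
  move=> e; rewrite eqxx; set W := top n _ _.
  suff -> : W = top n X (if e is Minus then A else act Minus (S `|` T) A) by case: e @W.
  by rewrite /W eST; apply: eq_top => j e' /ltn_eqF ->.
by rewrite eqxx; apply/movesP; split=> //; rewrite eST.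
Qed.

Lemma bd_lt i X Y j e : precell_bd Plus i X = precell_bd Minus i Y -> j < i ->
  X j e = Y j e.
Proof. by rewrite !precell_bdE => /(congr1 (fun X => X j e)) + ji; rewrite !top_lt. Qed.

Lemma bd_eq i X Y : precell_bd Plus i X = precell_bd Minus i Y -> X i Plus = Y i Minus.
Proof. by rewrite !precell_bdE => /(congr1 (fun X => X i Plus)); rewrite !top_eq. Qed.

Lemma cell_step e n X i f : is_cell n X -> i < n ->
  step e (X i.+1 f) (X i e) (X i (opp e)).
Proof.
by move=> [_ Xm _] /Xm mX; case: e; [apply/movesP|apply: moves_step].
Qed.

Lemma cell_last n X e : is_cell n X -> X n e = X n Minus.
Proof. by case: e => // -[[_ ]]. Qed.

Lemma comp_cell_of_top i n X Y : i < n -> is_cell n X -> is_cell n Y ->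
  is_cell n (top n (precell_comp i X Y) (X n Minus `|` Y n Minus)) ->
  is_cell n (precell_comp i X Y).
Proof.
move=> i_n cX cY; rewrite -top_comp // !top_id //; by case: cX cY => ? _ _ [].
Qed.

(** Induction on [n]. If [n] is [i.+1] the two tops are consecutive. Otherwise the boundaries
    compose by induction, and on their union the top of [X] is performed first, that of [Y] next.
    Disjointness of the tops is carried along because it keeps each move away from the other
    cell. *)
Lemma comp_cellP i n X Y : i < n -> is_cell n X -> is_cell n Y ->
  precell_bd Plus i X = precell_bd Minus i Y ->
  disj (X n Minus) (Y n Minus) /\ is_cell n (precell_comp i X Y).
Proof.
elim: n X Y => // m IHm X Y; rewrite ltnS leq_eqVlt => im cX cY XY.
have lt_im : i < m.+1 by rewrite ltnS leq_eqVlt.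
suff [d c] : disj (X m.+1 Minus) (Y m.+1 Minus) /\ is_cell m.+1
    (top m.+1 (precell_comp i X Y) (X m.+1 Minus `|` Y m.+1 Minus)).
  by split=> //; exact: comp_cell_of_top.
have mX := cell_mset Minus cX (ltnSn m); have mY := cell_mset Minus cY (ltnSn m).
have [sX dX aX] := cell_step Minus Minus cX (ltnSn m).
have [sY dY aY] := cell_step Minus Minus cY (ltnSn m).
case/predU1P: im => [im|{}im].
  subst i.
  have [||c d] := cell_consecutive (X := X) mX mY _ sX.
  - exact: cell_bd.
  - by rewrite -aX (bd_eq XY).
  split=> //; congr is_cell: c; apply: eq_top => j e; rewrite ltnS leq_eqVlt.
  case/predU1P => [->|jm]; first by rewrite eqxx precell_comp_eq -aX (bd_eq XY) -aY.
  by rewrite ltn_eqF // precell_comp_lt.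
have IH e e' : disj (X m e) (Y m e') /\
    is_cell m (top m (precell_comp i X Y) (X m e `|` Y m e')).
  have [] := IHm (top m X (X m e)) (top m Y (Y m e')) im.
  - exact: cell_bd.
  - exact: cell_bd.
  - have bd_top Z A f : precell_bd f i (top m Z A) = precell_bd f i Z.
      rewrite !precell_bdE top_lt //; apply: eq_top => j f' ji.
      by rewrite top_lt //; exact: ltn_trans im.
    by rewrite !bd_top.
  by rewrite !top_eq top_comp.
have [dMM cMM] := IH Minus Minus; have [dPM cPM] := IH Plus Minus.
set S := X m.+1 Minus in mX sX dX aX *; set T := Y m.+1 Minus in mY sY dY aY *.
have sSA : border Minus S `<=` X m Minus `|` Y m Minus by move=> z /sX; left.
have sTA : border Minus T `<=` X m Plus `|` Y m Minus by move=> z /sY; right.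
have [dSA _] := cell_act cMM mX sSA.
have [dTA _] := cell_act cPM mY sTA.
(* A source of [S] is either a target of [S], kept out of [Y m Minus] by gluing, or in [X m Minus],
   which is disjoint from it by induction. *)
have dSY : disj (faces Minus S) (Y m Minus).
  move=> z Sz Yz; have [Sz'|nSz] := pselect (faces Plus S z).
    by apply: (dSA z) => //; right.
  by apply: (dMM z) => //; apply: sX.
have dTX : disj (faces Minus T) (X m Plus).
  move=> z Tz Xz; have [Tz'|nTz] := pselect (faces Plus T z).
    by apply: (dTA z) => //; left.
  by apply: (dPM z) => //; apply: sY.
have aS : act Minus S (X m Minus `|` Y m Minus) = X m Plus `|` Y m Minus.
  by rewrite actUl // -aX.
have aT : act Minus T (X m Plus `|` Y m Minus) = X m Plus `|` Y m Plus.
  by rewrite actUr // -aY.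
have [|c d] := cell_consecutive mX mY cMM sSA; first by rewrite aS.
split=> //; congr is_cell: c; apply: eq_top => j e; rewrite ltnS leq_eqVlt.
case/predU1P => [->|jm]; last by rewrite ltn_eqF.
by rewrite eqxx precell_comp_gt // aS aT; case: e.
Qed.

End Composition.

(** * The strict omega-category of cells *)

Section CellCategory.
Variable P : omegaHypergraph.
Implicit Types (e : sign) (X Y Z : precell P).

Lemma bd_bd_precell e e' i j X : i < j ->
  precell_bd e i (precell_bd e' j X) = precell_bd e i X.
Proof.
move=> ij; rewrite !precell_bdE top_lt //; apply: eq_top => k f ki.
by rewrite top_lt //; exact: ltn_trans ij.
Qed.

Lemma bd_precell_id e n X : is_precell n X -> precell_bd e n X = X.
Proof. exact: top_id. Qed.

Lemma bd_comp_src_precell i X Y :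
  precell_bd Minus i (precell_comp i X Y) = precell_bd Minus i X.
Proof.
rewrite !precell_bdE precell_comp_eq; apply: eq_top => k f ki.
by rewrite precell_comp_lt.
Qed.

Lemma bd_comp_tgt_precell i X Y : precell_bd Plus i X = precell_bd Minus i Y ->
  precell_bd Plus i (precell_comp i X Y) = precell_bd Plus i Y.
Proof.
move=> XY; rewrite !precell_bdE precell_comp_eq; apply: eq_top => k f ki.
by rewrite precell_comp_lt // (bd_lt _ XY).
Qed.

Lemma bd_comp_precell e i j X Y : i < j ->
  precell_bd e j (precell_comp i X Y) =
  precell_comp i (precell_bd e j X) (precell_bd e j Y).
Proof. by move=> ij; rewrite !precell_bdE top_comp // precell_comp_gt. Qed.

Lemma comp_idl_precell i X : precell_comp i (precell_bd Minus i X) X = X.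
Proof.
apply/funext=> k; apply/funext=> e; rewrite /precell_comp /precell_bd.
by case: ltngtP => [//|_|->]; [rewrite set0U|case: e; rewrite ?ltnn ?eqxx].
Qed.

Lemma comp_idr_precell i X : precell_comp i X (precell_bd Plus i X) = X.
Proof.
apply/funext=> k; apply/funext=> e; rewrite /precell_comp /precell_bd.
by case: ltngtP => [//|_|->]; [rewrite setU0|case: e; rewrite ?ltnn ?eqxx].
Qed.

Lemma comp_assoc_precell i X Y Z :
  precell_comp i (precell_comp i X Y) Z = precell_comp i X (precell_comp i Y Z).
Proof.
apply/funext=> k; apply/funext=> e; rewrite /precell_comp.
by case: ltngtP => [//|_|_]; [rewrite setUA|case: e; rewrite ?ltnn ?eqxx].
Qed.

Lemma comp_exchange_precell i j X Y X' Y' : i < j ->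
  precell_comp j (precell_comp i X Y) (precell_comp i X' Y') =
  precell_comp i (precell_comp j X X') (precell_comp j Y Y').
Proof.
move=> ij; apply/funext=> k; apply/funext=> e; rewrite /precell_comp.
case: (ltngtP k i) => [ki|ik|->]; last by rewrite ij; case: e.
  by rewrite (ltn_trans ki ij).
case: (ltngtP k j) => [//|_|ekj]; first exact: setUACA.
by rewrite ltnNge ltnW //= gtn_eqF //; case: e.
Qed.

Hypothesis nonempty : nonemptiness_axiom P.
Hypothesis acyclic : acyclicity_axiom P.
Hypothesis relevant : relevance_axiom P.
Hypothesis segment : segment_axiom P.

Lemma cell_id i n X : i < n -> is_cell i X -> is_cell n X.
Proof.
move=> lt_in [[Xfs Xi X0] Xm Xf].
have X00 k e : i < k -> X k e = set0 by exact: X0.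
have ff0 k : 0 < k -> @fork_free P k set0 by move=> k0; right.
split.
- split=> // [|k e nk]; first by rewrite !X0.
  by apply: X0; exact: ltn_trans nk.
- move=> k e kn; have [ki|] := ltnP k i; first exact: Xm.
  rewrite leq_eqVlt => /predU1P[<-|ik].
    by rewrite X0 // /moves /faces !bigcup_set0 !setU0 !setD0.
  by rewrite !X0 //; [rewrite /moves /faces !bigcup_set0 !setU0 !setD0|exact: ltnW].
- move=> k e kn; have [ki|ik] := leqP k i; first exact: Xf.
  by rewrite X0 //; apply: ff0; exact: leq_ltn_trans ik.
Qed.

Definition cell_bdm e n i (h : i < n) (X : Cell P n) : Cell P i :=
  exist _ (precell_bd e i (sval X)) (cell_bd e (ltnW h) (svalP X)).

Definition cell_idm i n (h : i < n) (X : Cell P i) : Cell P n :=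
  exist _ (precell_id (sval X)) (cell_id h (svalP X)).

Lemma cell_bdmP n i (h : i < n) (X Y : Cell P n) :
  cell_bdm Plus h X = cell_bdm Minus h Y ->
  precell_bd Plus i (sval X) = precell_bd Minus i (sval Y).
Proof. exact: (congr1 sval). Qed.

Definition cell_comp n i (h : i < n) (X Y : Cell P n)
    (XY : cell_bdm Plus h X = cell_bdm Minus h Y) : Cell P n :=
  exist _ (precell_comp i (sval X) (sval Y))
    (comp_cellP nonempty acyclic relevant segment h (svalP X) (svalP Y)
       (cell_bdmP XY)).2.

Lemma sval_inj T (Q : T -> Prop) : injective (@sval T Q).
Proof. by move=> [x Qx] [y Qy] /= xy; subst y; congr exist; exact: Prop_irrelevance. Qed.

(** Transparent, so that its operations compute to those on pre-cells. *)
Definition cell_omegaCat : omegaCat (Cell P).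
Proof.
apply: (@OmegaCat (Cell P) cell_bdm cell_idm cell_comp).
- by move=> e e' n j i hj hi hi' X; apply: sval_inj; exact: bd_bd_precell.
- by move=> i j n hj hn hn' X; exact: sval_inj.
- by move=> e i n hi [X cX]; apply: sval_inj; apply: bd_precell_id; case: cX.
- by move=> n i hi X Y h; apply: sval_inj; exact: bd_comp_src_precell.
- by move=> n i hi X Y h; apply: sval_inj; apply: bd_comp_tgt_precell; exact: cell_bdmP h.
- by move=> e n j i hi hj hij X Y h h'; apply: sval_inj; exact: bd_comp_precell.
- by move=> n i hi X h; apply: sval_inj; exact: comp_idl_precell.
- by move=> n i hi X h; apply: sval_inj; exact: comp_idr_precell.
- by move=> n i hi X Y Z hXY hYZ hl hr; apply: sval_inj; exact: comp_assoc_precell.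
- by move=> n j i hi hj X Y X' Y' hXY hXY' hXX hYY hl hr ij; apply: sval_inj;
    exact: comp_exchange_precell.
- by move=> n m i hm hi hi' X Y h h'; exact: sval_inj.
Defined.

End CellCategory.

(** * Transport of structure along a graded bijection *)

Section Transport.
Variables (C D : nat -> Type) (SC : omegaCat C).
Variables (F : forall n, C n -> D n) (G : forall n, D n -> C n).
Hypotheses (FK : forall n, cancel (@F n) (@G n)) (GK : forall n, cancel (@G n) (@F n)).

Definition transport_bd e n i (h : i < n) (X : D n) : D i := F (bd SC e h (G X)).

Definition transport_idm i n (h : i < n) (X : D i) : D n := F (idm SC h (G X)).

Lemma transport_bdP e e' n i (h : i < n) (X Y : D n) :
  transport_bd e h X = transport_bd e' h Y -> bd SC e h (G X) = bd SC e' h (G Y).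
Proof. exact: (can_inj (@FK i)). Qed.

Definition transport_comp n i (h : i < n) (X Y : D n)
    (XY : transport_bd Plus h X = transport_bd Minus h Y) : D n :=
  F (Defs.comp (transport_bdP XY)).

Lemma comp_congr n i (h : i < n) (X Y X' Y' : C n)
    (XY : bd SC Plus h X = bd SC Minus h Y) (XY' : bd SC Plus h X' = bd SC Minus h Y') :
  X = X' -> Y = Y' -> Defs.comp XY = Defs.comp XY'.
Proof. by move=> eX eY; subst X' Y'; congr Defs.comp; exact: Prop_irrelevance. Qed.

(** Each law is that of [SC] at the images under [G]; the composability proofs have to be rebuilt,
    as [G (F X) = X] holds only propositionally. *)
Definition transport_omegaCat : omegaCat D.
Proof.
apply: (@OmegaCat D transport_bd transport_idm transport_comp);
  rewrite /transport_bd /transport_idm /transport_comp.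
- by move=> e e' n j i hj hi hi' X; rewrite FK (bd_bd _ _ _ _ _ hi').
- by move=> i j n hj hn hn' X; rewrite FK (idm_idm _ _ _ hn').
- by move=> e i n hi X; rewrite FK bd_idm GK.
- by move=> n i hi X Y h; rewrite FK bd_comp_src.
- by move=> n i hi X Y h; rewrite FK bd_comp_tgt.
- move=> e n j i hi hj hij X Y h h'; rewrite FK; congr F.
  set h1 := transport_bdP h.
  have h2 : bd SC Plus hij (bd SC e hj (G X)) = bd SC Minus hij (bd SC e hj (G Y)).
    by have := transport_bdP h'; rewrite !FK.
  by rewrite (bd_comp h1 h2); apply: comp_congr; rewrite FK.
- move=> n i hi X h; rewrite -[RHS]GK; congr F.
  have h1 : bd SC Plus hi (idm SC hi (bd SC Minus hi (G X))) = bd SC Minus hi (G X).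
    by rewrite bd_idm.
  by rewrite -[RHS](comp_idl h1); apply: comp_congr; rewrite // !FK.
- move=> n i hi X h; rewrite -[RHS]GK; congr F.
  have h1 : bd SC Plus hi (G X) = bd SC Minus hi (idm SC hi (bd SC Plus hi (G X))).
    by rewrite bd_idm.
  by rewrite -[RHS](comp_idr h1); apply: comp_congr; rewrite // !FK.
- move=> n i hi X Y Z hXY hYZ hl hr; congr F.
  have hl' : bd SC Plus hi (Defs.comp (transport_bdP hXY)) = bd SC Minus hi (G Z).
    by have := transport_bdP hl; rewrite FK.
  have hr' : bd SC Plus hi (G X) = bd SC Minus hi (Defs.comp (transport_bdP hYZ)).
    by have := transport_bdP hr; rewrite FK.
  transitivity (Defs.comp hl'); first by apply: comp_congr; rewrite ?FK.
  by rewrite (comp_assoc hl' hr'); apply: comp_congr; rewrite ?FK.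
- move=> n j i hi hj X Y X' Y' hXY hXY' hXX hYY hl hr ij; congr F.
  have hl' : bd SC Plus hj (Defs.comp (transport_bdP hXY)) =
             bd SC Minus hj (Defs.comp (transport_bdP hXY')).
    by have := transport_bdP hl; rewrite !FK.
  have hr' : bd SC Plus hi (Defs.comp (transport_bdP hXX)) =
             bd SC Minus hi (Defs.comp (transport_bdP hYY)).
    by have := transport_bdP hr; rewrite !FK.
  transitivity (Defs.comp hl'); first by apply: comp_congr; rewrite ?FK.
  by rewrite (comp_exchange hl' hr' ij); apply: comp_congr; rewrite ?FK.
- move=> n m i hm hi hi' X Y h h'; rewrite FK; congr F.
  have h1 : bd SC Plus hi' (idm SC hm (G X)) = bd SC Minus hi' (idm SC hm (G Y)).
    by have := transport_bdP h'; rewrite !FK.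
  by rewrite (idm_comp (transport_bdP h) h1); apply: comp_congr; rewrite FK.
Defined.

Lemma transport_isomorphism : is_isomorphism SC transport_omegaCat F.
Proof.
split.
  split=> [e n i h X|i n h X|n i h X Y XY XY'].
  - by rewrite /= /transport_bd FK.
  - by rewrite /= /transport_idm FK.
  - by rewrite /= /transport_comp; congr F; apply: comp_congr; rewrite FK.
exists G; split=> //; split=> [e n i h X|i n h X|n i h X Y XY XY'].
- by rewrite /= /transport_bd FK.
- by rewrite /= /transport_idm FK.
- by rewrite /= /transport_comp FK; exact: comp_congr.
Qed.

End Transport.

(** * Closed sets and their levels *)

Section Closure.
Variable P : omegaHypergraph.
Implicit Types (U V M S T A B : set P) (u v x y z : P) (e : sign) (X Y : precell P).

Lemma hrel_refl x : hrel x x. Proof. exact: rt_refl. Qed.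

Lemma hrel_trans x y z : hrel x y -> hrel y z -> hrel x z.
Proof. exact: rt_trans. Qed.

Lemma hrel_face e x y : face e x y -> hrel x y.
Proof. by move=> xy; apply: rt_step; case: e xy; [left|right]. Qed.

Lemma hrel_inv x y : hrel x y -> x = y \/ exists e z, face e x z /\ hrel z y.
Proof.
elim=> [{}x {}y [xy|xy]||{}x {}y z xy IHxy yz IHyz]; try by left.
- by right; exists Minus, y; split=> //; exact: hrel_refl.
- by right; exists Plus, y; split=> //; exact: hrel_refl.
case: IHxy => [-> //|[e [w [xw wy]]]]; right; exists e, w; split=> //.
exact: hrel_trans wy yz.
Qed.

Lemma hrel_dim x y : hrel x y -> hdim y <= hdim x.
Proof.
by elim=> [{}x {}y [/face_dim->|/face_dim->] //|//|{}x {}y z _ xy _ /leq_trans]; apply.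
Qed.

Lemma hrel_eq_dim x y : hrel x y -> hdim x <= hdim y -> x = y.
Proof.
move=> /hrel_inv[//|[e [z [/face_dim xz /hrel_dim zy]]]]; rewrite xz => yz.
by have := leq_trans yz zy; rewrite ltnn.
Qed.

Lemma sub_hclosure U : U `<=` hclosure U.
Proof. by move=> u Uu; exists u => //; exact: hrel_refl. Qed.

Lemma hclosure_closed U : is_closed (hclosure U).
Proof.
apply/seteqP; split; last exact: sub_hclosure.
by move=> u [v [w Uw wv] vu]; exists w => //; exact: hrel_trans vu.
Qed.

Lemma hclosureS U V : U `<=` V -> hclosure U `<=` hclosure V.
Proof. by move=> sUV y [x /sUV Vx xy]; exists x. Qed.

Lemma hclosure_min U V : U `<=` V -> is_closed V -> hclosure U `<=` V.
Proof. by move=> /hclosureS sUV <-. Qed.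

Lemma hclosure_faces e U : hclosure (faces e U) `<=` hclosure U.
Proof.
by move=> y [z [x Ux xz] zy]; exists x => //; exact: hrel_trans (hrel_face xz) zy.
Qed.

Lemma hclosureU U V : hclosure (U `|` V) = hclosure U `|` hclosure V.
Proof.
apply/seteqP; split=> y; last by case; apply: hclosureS; [left|right].
by move=> [x [Ux|Vx] xy]; [left|right]; exists x.
Qed.

(** Induction on dimension: an element has finitely many faces, all of lower dimension. *)
Lemma hclosure_finite U : finite_set U -> finite_set (hclosure U).
Proof.
have fin1 n x : hdim x < n -> finite_set (hclosure [set x]).
  elim: n x => // n IHn x; rewrite ltnS => hx.
  have faces_fin e : finite_set (\bigcup_(z in face e x) hclosure [set z]).
    apply: bigcup_finite; first exact: face_finite.
    by move=> z /face_dim hz; apply: IHn; rewrite -ltnS -hz.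
  apply: (@sub_finite_set _ _ ([set x] `|` \bigcup_(z in face Minus x) hclosure [set z]
      `|` \bigcup_(z in face Plus x) hclosure [set z])).
    move=> y [_ -> /hrel_inv[<-|[e [z [xz zy]]]]]; first by left; left.
    by case: e xz => xz; [left; right|right]; exists z => //; exists z.
  by rewrite !finite_setU; do !split=> //; exact: finite_set1.
move=> fU; apply: (@sub_finite_set _ _ (\bigcup_(x in U) hclosure [set x])).
  by move=> y [x Ux xy]; exists x => //; exists x.
by apply: bigcup_finite => // x _; apply: (fin1 (hdim x).+1).
Qed.

Lemma hclosure_eq_dim U n y : (forall x, U x -> hdim x <= n) -> hdim y = n ->
  hclosure U y -> U y.
Proof.
by move=> dU hy [x Ux xy]; rewrite -(hrel_eq_dim xy) // hy; exact: dU.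
Qed.

(** The set generating the boundary has no element above dimension [n], so closing it adds nothing
    in dimension [n]. *)
Lemma level_clbd e n U : is_fgs n.+1 U -> is_closed U ->
  level n (clbd e n.+1 U) = level n U `\` faces (opp e) (level n.+1 U).
Proof.
move=> [_ dU] cU; set M := level n.+1 U.
have sM : M `<=` stage n.+1 by move=> x [].
apply/seteqP; split=> y.
  move=> [[x [Ux nx] xy] hy].
  have <- : x = y.
    apply: hrel_eq_dim => //; rewrite hy -ltnS ltn_neqAle dU // andbT.
    by apply/eqP => hx; apply: nx; left.
  split; last by move=> ?; apply: nx; right; exact: sub_hclosure.
  split=> //; rewrite /stage /=; apply/eqP; rewrite eqn_leq.
  rewrite -{2}hy (hrel_dim xy) andbT -ltnS ltn_neqAle dU // andbT.
  by apply/eqP => hx; apply: nx; left.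
move=> [[Uy hy] nMy]; split=> //; apply: sub_hclosure; split=> // -[[_]|].
  by rewrite /stage /= hy => /n_Sn.
move=> /(@hclosure_eq_dim _ n) My; apply: nMy; apply: My => // x.
by move/(faces_stage sM) ->.
Qed.

Lemma clbd_sub e n U : is_closed U -> clbd e n U `<=` U.
Proof. by move=> cU; apply: hclosure_min => // x []. Qed.

Definition cell_fgs n X : set P := hclosure (precell_union n X).

Lemma precell_union_finite n X : is_precell n X -> finite_set (precell_union n X).
Proof.
move=> [Xfs _ _]; apply: (@sub_finite_set _ _
  (\bigcup_(i in `I_n.+1) (X i Minus `|` X i Plus))).
  by move=> x [i [e [le_in Xx]]]; exists i => //; case: e Xx; [left|right].
apply: bigcup_finite; first exact: finite_II.
by move=> i _; rewrite finite_setU; split; apply Xfs.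
Qed.

Lemma precell_union_dim n X x : is_precell n X -> precell_union n X x -> hdim x <= n.
Proof. by move=> [Xfs _ _] [i [e [le_in Xx]]]; have [_ /(_ _ Xx) ->] := Xfs i e. Qed.

Lemma cell_fgsP n X : is_precell n X -> is_fgs n (cell_fgs n X).
Proof.
move=> pX; split; first exact/hclosure_finite/precell_union_finite.
by move=> u [x /(precell_union_dim pX) xn /hrel_dim xu]; exact: leq_trans xn.
Qed.

Lemma sub_cell_fgs n X i e : i <= n -> X i e `<=` cell_fgs n X.
Proof. by move=> le_in x Xx; apply: sub_hclosure; exists i, e. Qed.

Lemma level_cell_fgs n X e : is_precell n X -> level n (cell_fgs n X) = X n e.
Proof.
move=> pX; have [Xfs Xn _] := pX; apply/seteqP; split=> x; last first.
  by move=> Xx; split; [exact: sub_cell_fgs Xx|apply Xfs in Xx].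
move=> [+ hx]; move=> /(@hclosure_eq_dim _ n) -/(_ _ hx)[|i [f [le_in Xx]]].
  by move=> y; exact: precell_union_dim.
have [_ /(_ _ Xx) hxi] := Xfs i f; have ein : i = n by rewrite -hxi -hx.
by move: Xx; rewrite ein; case: e f => [] []; rewrite ?Xn.
Qed.

(** * Boundaries of the closed set of a cell *)

Hypothesis nonempty : nonemptiness_axiom P.
Hypothesis acyclic : acyclicity_axiom P.
Hypothesis relevant : relevance_axiom P.
Hypothesis segment : segment_axiom P.

(** Perform first what precedes [x]: nothing left creates a source of [x], so [face Minus x] is
    present. Performing [x] as well brings in [face Plus x]. *)
Lemma cell_around n X x e : is_cell n.+1 X -> X n.+1 Minus x ->
  exists2 E, is_cell n (top n X E) & face e x `<=` E.
Proof.
move=> cX Xx; set M := X n.+1 Minus in Xx.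
have mM : mset n M by exact: (cell_mset (n := n.+1)).
have [sMA dMA _] := cell_step Minus Minus cX (ltnSn n).
have cA : is_cell n (top n X (X n Minus)) by exact: (cell_bd (n := n.+1)).
rewrite -/M in sMA dMA.
have sM : M `<=` stage n.+1 by case: mM.
pose U := [set u | M u /\ tri (stage n.+1) u x].
pose V := [set u | M u /\ ~ U u /\ u <> x].
have eM : M = U `|` ([set x] `|` V).
  apply/seteqP; split=> u; last by case=> [[]|[->|[]]].
  move=> Mu; have [Uu|nUu] := pselect (U u); first by left.
  by right; have [->|nux] := pselect (u = x); [left|right].
have sUM : U `<=` M by move=> u [].
have sVM : [set x] `|` V `<=` M by move=> u [->|[]].
have dVU : disj (faces Plus ([set x] `|` V)) (faces Minus U).
  move=> z [u xVu uz] [v [Mv vx] vz].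
  have ux : tri (stage n.+1) u x.
    by apply: tri_trans vx; apply: tri_stage uz vz; exact: sM (sVM _ xVu).
  by case: xVu ux => [->|[Mu [nUu _]] ux]; [exact: acyclic|apply: nUu].
have dUV : disj (faces Minus U) (faces Minus ([set x] `|` V)).
  apply: mset_disj mM sUM sVM _ => u Uu [ux|[_ [//]]].
  by case: Uu => _; rewrite ux; exact: acyclic.
have sUA : border Minus U `<=` X n Minus.
  by apply: (border_split (e := Minus) dVU); rewrite -eM.
have [_ cE] := cell_act nonempty acyclic relevant segment cA (msetS mM sUM) sUA.
set E := act Minus U (X n Minus) in cE.
have sVE : border Minus ([set x] `|` V) `<=` E by apply: border_split_act; rewrite -?eM.
have sxE : face Minus x `<=` E.
  move=> z xz; apply: sVE; split; first by exists x => //; left.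
  move=> [u xVu uz]; have ux : tri (stage n.+1) u x.
    by apply: tri_stage uz xz; exact: sM (sVM _ xVu).
  by case: xVu ux => [->|[Mu [nUu _]] ux]; [exact: acyclic|apply: nUu].
case: e; first by exists E.
have [|_ cE'] := cell_act nonempty acyclic relevant segment cE (mset1 (sM _ Xx)).
  by move=> z []; rewrite faces1 => /sxE.
exists (act Minus [set x] E) => // z xz; split; rewrite faces1; first by right.
by move=> mz; apply: (@face_disj _ acyclic Minus x z).
Qed.

(** The two faces of [x] share their borders, so it suffices to put [y] below a border of
    [face e x]. If [j.+1 = n], then [y] is a face of an element of [face e x], and being in [X j f]
    it is no face of sign [opp f], hence lies in the border. Lower down, the first hypothesis
    applies; it is the induction hypothesis of [boundary_border]. *)
Lemma boundary_face n X E x e f j y :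
  (forall S, is_cell n (top n X E) -> S `<=` E -> j.+1 < n -> hclosure S y ->
     hclosure (border Minus S) y) ->
  is_cell n (top n X E) -> hdim x = n.+1 -> face e x `<=` E ->
  j < n -> X j f y -> hclosure (face e x) y ->
  hclosure (face (opp e) x) y.
Proof.
case: n => // n IH cE hx sxE; rewrite ltnS leq_eqVlt => jn Xy xy.
suff [g yg] : exists g, hclosure (border g (face e x)) y.
  have bE : border g (face e x) = border g (face (opp e) x).
    by case: (e); rewrite /= (face_border acyclic relevant g hx).
  move: yg; rewrite bE => yg; apply: (@hclosure_faces g).
  by apply: hclosureS yg => z [].
case/predU1P: jn => [ejn|jn]; last first.
  by exists Minus; apply: IH.
subst j; exists f.
have hy : hdim y = n.
  case: cE => -[/(_ n f) + _ _] _ _; rewrite (@top_lt _ n.+1) // => -[_]; exact.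
have [z xz zy] := xy.
have hz : hdim z = n.+1 by have := face_dim xz; rewrite hx => -[].
have [ezy|[g [w [zw wy]]]] := hrel_inv zy.
  by move: hz; rewrite ezy hy => /n_Sn.
have ewy : w = y.
  apply: hrel_eq_dim => //; have := face_dim zw; rewrite hz => -[<-].
  by rewrite hy.
rewrite {}ewy {wy} in zw.
have [_ dEX _] := cell_step f Minus cE (ltnSn n).
rewrite top_eq (@top_lt _ n.+1) // in dEX.
have nfy : ~ faces (opp f) (face e x) y.
  by move=> /(facesS sxE) Ey; exact: dEX Ey Xy.
apply: sub_hclosure; split=> //; exists z => //.
by case: f g zw nfy {Xy dEX} => [] [] zw nfy //; case: nfy; exists z.
Qed.

(* Choose [x] in [S] above [y] that is minimal in the direction [e]: [y] is below a
   face of [x] in this direction, as [face Minus x] and [face Plus x] have the same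
   borders, and by minimality this face is in [border e S]. *)
Lemma boundary_border n X S i f y e : is_cell n X -> S `<=` X n Minus ->
  i.+1 < n -> X i f y -> hclosure S y -> hclosure (border e S) y.
Proof.
elim: n X S i f y e => // n IHn X S i f y e cX sSX; rewrite ltnS => lt_in Xy [x0 Sx0 x0y].
have [fM sM ffM] := cell_mset Minus cX (ltnSn n); set M := X n.+1 Minus in sSX fM sM ffM.
have [|||x [Sx xy] minx] := @minimal_face _ acyclic n e [set x | S x /\ hrel x y].
- by apply: sub_finite_set fM => u [/sSX].
- by move=> u [/sSX/sM].
- by exists x0.
have hx : hdim x = n.+1 by exact/sM/sSX.
have hy : hdim y = i by case: cX => -[/(_ i f)[_ +] _ _] _ _; exact.
have [exy|[g [z [xz zy]]]] := hrel_inv xy.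
  by move: hy; rewrite -exy hx => ei; move: lt_in; rewrite -ei ltnNge leqnSn.
have [z' xz' z'y] : hclosure (face e x) y.
  have : hclosure (face g x) y by exists z.
  (* If [y] lies below the face of sign opposite to [e], it is carried across [x] inside an
     intermediate cell containing that face. *)
  have [E cE sxE] := cell_around g cX (sSX _ Sx).
  have [<- //|nge] := pselect (g = e).
  have -> : e = opp g by case: e g nge {minx xz sxE} => [] [].
  apply: (boundary_face _ cE hx sxE lt_in Xy) => //.
  move=> T _ sTE lt_in' Ty; apply: (IHn _ T i f y _ cE) => //; first by rewrite top_eq.
  by rewrite top_lt //; exact: ltnW.
exists z' => //; split; first by exists x.
move=> [x' Sx' x'z']; apply: (minx z') => //; exists x' => //.
by split=> //; exact: hrel_trans (hrel_face x'z') z'y.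
Qed.

(** A surviving element below [M] is below a face in [border e M], hence below [X n e]. Conversely
    [X n e] survives, and [boundary_border] recovers the lower dimensions. *)
Lemma clbd_cell_fgs e n X : is_cell n.+1 X ->
  clbd e n.+1 (cell_fgs n.+1 X) = cell_fgs n (precell_bd e n X).
Proof.
move=> cX; have [pX _ _] := cX; have [Xfs _ _] := pX.
rewrite precell_bdE /clbd (level_cell_fgs Minus pX); set M := X n.+1 Minus.
have [sM dM aM] := cell_step e Minus cX (ltnSn n); rewrite -/M in sM dM aM.
have [_ sMs _] := cell_mset Minus cX (ltnSn n); rewrite -/M in sMs.
set W := _ `\` _.
have subW : X n e `<=` W.
  move=> x Xx; have [_ /(_ _ Xx) hx] := Xfs n e; split.
    by apply: (sub_cell_fgs (e := e) (leqnSn n)).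
  case=> [/sMs|]; first by rewrite /stage /= hx => /n_Sn.
  move=> /(@hclosure_eq_dim _ n) -/(_ _ hx) Mx; apply: (dM x) => //; apply: Mx.
  by move=> y /(faces_stage sMs) ->.
apply/seteqP; split; apply: hclosure_min; try exact: hclosure_closed.
  move=> v [[x [i [f [le_in Xx]]] xv] nv].
  have sub_bd j g : j < n -> X j g `<=` cell_fgs n (top n X (X n e)).
    move=> jn w Xw; apply: (sub_cell_fgs (ltnW jn) (e := g)).
    by rewrite top_lt.
  have sub_bd_n : X n e `<=` cell_fgs n (top n X (X n e)).
    by move=> w Xw; apply: (sub_cell_fgs (leqnn n) (e := e)); rewrite top_eq.
  have closed_bd := @hclosure_closed (precell_union n (top n X (X n e))).
  move: le_in; rewrite leq_eqVlt => /predU1P[ein|].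
    have Mx : M x by rewrite /M -(cell_last f cX) -ein.
    have [exv|[g [z [xz zv]]]] := hrel_inv xv.
      by case: nv; left; rewrite -exv.
    rewrite -[cell_fgs _ _]closed_bd; exists z => //; apply/sub_bd_n/sM.
    have nMz : ~ faces (opp e) M z.
      by move=> Mz; apply: nv; right; exists z.
    split=> //; case: (e) g xz nMz => [] [] xz nMz;
      by [exists x | case: nMz; exists x].
  rewrite ltnS leq_eqVlt => /predU1P[ein|lt_in]; last first.
    by rewrite -[cell_fgs _ _]closed_bd; exists x => //; exact: sub_bd Xx.
  have [Xex|nXx] := pselect (X n e x).
    by rewrite -[cell_fgs _ _]closed_bd; exists x => //; exact: sub_bd_n.
  (* An element of the other boundary outside [X n e] is created by [M], so all that lies below it
     is discarded. *)
  case: nv; right; exists x => //.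
  have : X n (opp e) x.
    by rewrite ein in Xx; case: (e) f Xx nXx => [] [].
  by rewrite aM => -[[]].
move=> y [i [f [le_in]]]; rewrite /top.
case: ifP => [lt_in Xy|nlt_in].
  have [yM|nyM] := pselect (hclosure (faces (opp e) M) y); last first.
    apply: sub_hclosure; split.
      by apply: (sub_cell_fgs (leqW le_in) (e := f)).
    case=> // /sMs; have [_ /(_ _ Xy)] := Xfs i f; rewrite /stage /= => -> ein.
    by move: lt_in; rewrite ein ltnNge leqnSn.
  have := boundary_border (S := M) e cX (fun _ Mx => Mx) lt_in Xy (hclosure_faces yM).
  by apply: hclosureS => z /sM /subW.
case: eqP => // _ Xy; exact/sub_hclosure/subW.
Qed.

Lemma clbd_iter_cell_fgs e n i X : is_cell n X -> i <= n ->
  clbd_iter e n i (cell_fgs n X) = cell_fgs i (precell_bd e i X).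
Proof.
elim: n X => [|n IHn] X cX.
  by rewrite leqn0 => /eqP->; rewrite bd_precell_id //; case: cX.
rewrite leq_eqVlt => /predU1P[->|lt_in]; rewrite /= ?ltnn.
  by rewrite bd_precell_id //; case: cX.
rewrite lt_in clbd_cell_fgs //; rewrite ltnS in lt_in; rewrite IHn //; last first.
  exact: cell_bd.
move: lt_in; rewrite leq_eqVlt => /predU1P[->|lt_in]; last by rewrite bd_bd_precell.
by rewrite !precell_bdE top_idem top_eq.
Qed.

(** * The bijection between cells and closed-well-formed sets *)

Lemma cell_fgs_inj n X Y : is_cell n X -> is_cell n Y ->
  cell_fgs n X = cell_fgs n Y -> X = Y.
Proof.
move=> cX cY eXY; apply/funext=> i; apply/funext=> e.
have [lt_ni|le_in] := ltnP n i.
  by case: cX cY => -[_ _ X0] _ _ [[_ _ Y0] _ _]; rewrite X0 // Y0.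
have levelE Z : is_cell n Z -> Z i e = level i (clbd_iter e n i (cell_fgs n Z)).
  move=> cZ; rewrite clbd_iter_cell_fgs // (level_cell_fgs e) ?precell_bdE ?top_eq //.
  by have [] := cell_bd e le_in cZ.
by rewrite (levelE X) // (levelE Y) // eXY.
Qed.

Lemma cell_fgs_closed_wf n X : is_cell n X -> closed_wf n (cell_fgs n X).
Proof.
elim: n X => [|n IHn] X cX; have [pX _ Xf] := cX.
  split=> //; [exact: cell_fgsP|exact: hclosure_closed|].
  by rewrite (level_cell_fgs Minus) //; exact: Xf.
split; [exact: cell_fgsP|exact: hclosure_closed| |].
  by rewrite (level_cell_fgs Minus) //; exact: Xf.
split=> [e|].
  by rewrite clbd_cell_fgs //; apply: IHn; exact: cell_bd.
case: n IHn cX {pX Xf} => // n _ cX _ e.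
rewrite !clbd_cell_fgs //; [|exact: cell_bd..].
by rewrite !bd_bd_precell.
Qed.

(** By induction the two boundaries of [U] come from cells [A] and [B]. Globularity and injectivity
    make these agree below [n], and the top level of [U] moves the top of [A] to that of [B]. *)
Lemma closed_wf_cell_fgs n U : closed_wf n U -> exists2 X, is_cell n X & cell_fgs n X = U.
Proof.
elim: n U => [|n IHn] U.
  move=> [[_ dU] cU [[_ [a Ua]]|[]//] _].
  have U0 : U = [set a].
    rewrite -Ua; apply/seteqP; split=> [x Ux|x []//]; split=> //.
    by have := dU x Ux; rewrite leqn0 => /eqP.
  (* Nothing lies below dimension 0, so the first argument is a dummy. *)
  exists (top 0 (fun _ _ => set0) [set a]).
    apply/cell_top0; exists a => //; have : level 0 U a by rewrite Ua.
    by case.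
  rewrite -[RHS]cU /cell_fgs U0; congr hclosure; apply/seteqP; split=> x.
    by move=> [i [e [_]]]; rewrite /top ltn0; case: eqP.
  by move=> ->; exists 0, Minus; rewrite top_eq.
move=> [fU cU ffU [wfU globU]].
have [A cA FA] := IHn _ (wfU Minus); have [B cB FB] := IHn _ (wfU Plus).
have AB j e : j < n -> A j e = B j e.
  case: n IHn fU ffU wfU globU A cA FA B cB FB => // n _ _ _ _ globU A cA FA B cB FB jn.
  have bdAB f : precell_bd f n A = precell_bd f n B.
    apply: (cell_fgs_inj (n := n)); try exact: cell_bd.
    by rewrite -!clbd_cell_fgs // FA FB; exact: globU.
  have := congr1 (fun Z => Z j e) (bdAB e); rewrite !precell_bdE.
  move: jn; rewrite ltnS leq_eqVlt => /predU1P[->|jn]; first by rewrite !top_eq.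
  by rewrite !top_lt.
pose M := level n.+1 U.
have faceU e : faces e M `<=` level n U.
  move=> z Mz; split; last by apply: faces_stage Mz => x [].
  by case: Mz => x [Ux _] xz; rewrite -cU; exists x => //; exact: hrel_face xz.
have AE : A n Minus = level n U `\` faces Plus M.
  by rewrite -(@level_clbd Minus) // -FA (level_cell_fgs Minus) //; case: cA.
have BE : B n Minus = level n U `\` faces Minus M.
  by rewrite -(@level_clbd Plus) // -FB (level_cell_fgs Minus) //; case: cB.
pose Z : precell P := fun j e =>
  if j == n then (if e is Minus then A n Minus else B n Minus) else A j e.
have ZA j e : j < n -> Z j e = A j e by move=> jn; rewrite /Z ltn_eqF.
have Zn e : Z n e = if e is Minus then A n Minus else B n Minus by rewrite /Z eqxx.
exists (top n.+1 Z M).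
  apply/cell_topS; split.
  - case; rewrite Zn.
      by rewrite (eq_top _ ZA); exact: cell_top.
    rewrite (@eq_top _ _ _ B); first exact: cell_top.
    by move=> j e jn; rewrite ZA // AB.
  - split=> //; last by move=> x [].
    by apply: sub_finite_set fU.1 => x [].
  - rewrite /moves !Zn AE BE; split; apply/seteqP; split=> z /=;
      have := @faceU Minus z; have := @faceU Plus z;
      have [?|?] := pselect (faces Minus M z); have [?|?] := pselect (faces Plus M z);
      tauto.
have subA : cell_fgs n A `<=` cell_fgs n.+1 (top n.+1 Z M).
  apply: hclosureS => x [i [e [le_in Ax]]].
  move: le_in; rewrite leq_eqVlt => /predU1P[ein|lt_in].
    exists n, Minus; split=> //; rewrite top_lt // Zn -(cell_last e cA) -ein //.
  by exists i, e; split; [exact: leqW (ltnW lt_in)|rewrite top_lt ?ZA //; exact: leqW].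
apply/seteqP; split.
  apply: hclosure_min => // x [i [e [le_in]]].
  have cl f := @clbd_sub f n.+1 _ cU.
  move: le_in; rewrite leq_eqVlt => /predU1P[->|]; first by rewrite top_eq => -[].
  rewrite ltnS leq_eqVlt => /predU1P[->|lt_in].
    rewrite top_lt // Zn; case: e => [Ax|Bx].
      by apply: (cl Minus); rewrite -FA; exact: sub_cell_fgs Ax.
    by apply: (cl Plus); rewrite -FB; exact: sub_cell_fgs Bx.
  rewrite top_lt ?ZA //; last exact: leqW.
  by move=> Ax; apply: (cl Minus); rewrite -FA; apply: sub_cell_fgs Ax; exact: ltnW.
have subM : hclosure M `<=` cell_fgs n.+1 (top n.+1 Z M).
  by apply: hclosureS => x Mx; exists n.+1, Minus; rewrite top_eq.
(* What is neither in [M] nor below a target of [M] survives in the source boundary, hence comes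
   from [A]. *)
move=> u Uu; have [Mu|nMu] := pselect (M u); first exact/subM/sub_hclosure.
have [Mu|nfMu] := pselect (hclosure (faces Plus M) u).
  by apply: subM; exact: hclosure_faces Mu.
by apply: subA; rewrite FA; apply: sub_hclosure; split=> // -[].
Qed.

(** The composite omits only [X i Plus] and [Y i Minus]. The closure recovers them: the former is
    made of elements of [X i Minus] and targets from dimension [i.+1], the latter of elements of
    [Y i Plus] and sources. *)
Lemma cell_fgs_comp n i X Y : i < n -> is_cell n X -> is_cell n Y ->
  precell_bd Plus i X = precell_bd Minus i Y ->
  cell_fgs n (precell_comp i X Y) = cell_fgs n X `|` cell_fgs n Y.
Proof.
move=> lt_in cX cY XY; rewrite /cell_fgs -hclosureU; apply/seteqP; split.
  apply: hclosureS => x [j [e [jn]]]; rewrite /precell_comp.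
  case: ltngtP => [ji|ij|_].
  - by left; exists j, e.
  - by move=> [?|?]; [left|right]; exists j, e.
  - by case: e => ?; [left; exists i, Minus|right; exists i, Plus]; split=> //; exact: ltnW.
have sub j e : j <= n -> precell_comp i X Y j e `<=` cell_fgs n (precell_comp i X Y).
  exact: sub_cell_fgs.
have subX e : hclosure (X i.+1 e) `<=` cell_fgs n (precell_comp i X Y).
  apply: hclosure_min (hclosure_closed _) => x Xx; apply: (sub i.+1 e) => //.
  by rewrite precell_comp_gt //; left.
have subY e : hclosure (Y i.+1 e) `<=` cell_fgs n (precell_comp i X Y).
  apply: hclosure_min (hclosure_closed _) => x Yx; apply: (sub i.+1 e) => //.
  by rewrite precell_comp_gt //; right.
apply: hclosure_min (hclosure_closed _) => x.
move=> [[j [e [jn +]]]|[j [e [jn +]]]]; have := sub j e jn x; rewrite /precell_comp.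
- case: ltngtP => [_|_|->] h Xx; [exact: h|by apply: h; left|].
  case: e h Xx => h Xx; first exact: h.
  have [_ _ aX] := cell_step Minus Minus cX lt_in; move: Xx; rewrite aX => -[[Xx|Mx] _].
    by apply: (sub i Minus (ltnW lt_in)); rewrite precell_comp_eq.
  by apply: (subX Minus); apply: (@hclosure_faces Plus); exact: sub_hclosure.
- case: ltngtP => [ji|_|->] h Yx; [by apply: h; rewrite (bd_lt _ XY)|by apply: h; right|].
  case: e h Yx => h Yx; last exact: h.
  have [_ _ aY] := cell_step Plus Minus cY lt_in; move: Yx; rewrite aY => -[[Yx|My] _].
    by apply: (sub i Plus (ltnW lt_in)); rewrite precell_comp_eq.
  by apply: (subY Minus); apply: (@hclosure_faces Minus); exact: sub_hclosure.
Qed.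

End Closure.

(** * Assembly of the isomorphism *)

Theorem mainTheorem6 (P : omegaHypergraph) :
  nonemptiness_axiom P -> acyclicity_axiom P -> relevance_axiom P ->
  segment_axiom P ->
  exists (SC : omegaCat (Cell P)) (SW : omegaCat (ClosedWF P)),
    has_Cell_operations SC /\ has_ClosedWF_operations SW /\
    exists F : forall n : nat, Cell P n -> ClosedWF P n,
      (forall (n : nat) (X : Cell P n),
          sval (F n X) = hclosure (precell_union n (sval X))) /\
      is_isomorphism SC SW F.
Proof.
move=> nonempty acyclic relevant segment.
pose SC := cell_omegaCat nonempty acyclic relevant segment.
pose F n (X : Cell P n) : ClosedWF P n :=
  exist _ (cell_fgs n (sval X))
    (cell_fgs_closed_wf nonempty acyclic relevant segment (svalP X)).
have F_inj n : injective (@F n).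
  move=> X Y /(congr1 sval) /= eXY; apply: sval_inj.
  exact: cell_fgs_inj nonempty acyclic relevant segment _ _ _ (svalP X) (svalP Y) eXY.
(* Choosing preimages yields a function [G]; injectivity of [F] makes it a two-sided inverse. *)
have F_surj n (U : ClosedWF P n) : {X | F n X = U}.
  apply: cid; case: U => U wfU.
  have [X cX FX] := closed_wf_cell_fgs nonempty acyclic relevant segment wfU.
  by exists (exist _ X cX); exact: sval_inj.
pose G n U := sval (F_surj n U).
have GK n : cancel (@G n) (@F n) by move=> U; exact: svalP (F_surj n U).
have FK n : cancel (@F n) (@G n) by move=> X; apply: F_inj; exact: GK.
exists SC, (transport_omegaCat SC FK GK); split; first by split.
split; last by exists F; split=> //; exact: transport_isomorphism.
split=> [e n i h U|i n h U|n i h U V UV].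
- rewrite -{2}(GK _ U) /=; symmetry.
  exact: clbd_iter_cell_fgs nonempty acyclic relevant segment e n i _
    (svalP (G n U)) (ltnW h).
(* The pre-cell is unchanged and empty above [i], so the unions up to [i] and up to [n] agree. *)
- rewrite -{2}(GK _ U) /= /cell_fgs; congr hclosure; apply/seteqP; split=> x.
    move=> [j [f [jn Ux]]]; exists j, f; split=> //.
    have [[_ _ U0] _ _] := svalP (G i U); rewrite leqNgt; apply/negP => ij.
    by move: Ux; rewrite /precell_id U0.
  by move=> [j [f [ji Ux]]]; exists j, f; split=> //; exact: leq_trans (ltnW h).
- rewrite -{2}(GK _ U) -{2}(GK _ V) /=.
  apply: cell_fgs_comp => //; try exact: svalP.
  exact: (congr1 sval (transport_bdP FK UV)).
Qed.
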